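(* Let $p$ be an odd prime, $r\ge1$ and $q\ge1$. Then $$H_q(\mathrm{Hol}(\mathbb{Z}_{p^r});\mathbb{Z})\cong\bigoplus_{i=1}^r\Bigl(\bigoplus_{n_i}\mathbb{Z}_{p^i}\Bigr)\oplus\Bigl(\bigoplus_m\mathbb{Z}_{p-1}\Bigr),$$ where $m=1$ if $q$ is odd and $m=0$ otherwise, and the multiplicities $n_i$ are as follows ($k$ denotes a positive integer). If $r=1$: $n_1=1$ if $q=2(p-1)k-1$ for some $k$, and $n_1=0$ otherwise. If $r=2$: $$n_1=\Bigl[\frac q{2(p-1)p}\Bigr]+\alpha+\omega,$$ where $\alpha=1$ if $q=2(p-1)k-1$ for some $k$ with $(k,p)=1$ and $\alpha=0$ otherwise, and $\omega=1$ if $q$ is odd and $\omega=0$ otherwise; $n_2=1$ if $q=2(p-1)pk-1$ for some $k$, and $n_2=0$ otherwise. If $r\ge3$: for $1\le i\le r-2$, $$n_i=\Bigl[\frac q{2(p-1)p^i}\Bigr]-\Bigl[\frac q{2(p-1)p^{i+1}}\Bigr]+\alpha_i,$$ and $$n_{r-1}=\Bigl[\frac q{2(p-1)p^{r-1}}\Bigr]+\alpha_{r-1}+\omega,$$ where $\alpha_i=1$ if $q=2(p-1)p^{i-1}k-1$ for some $k$ with $(k,p)=1$ and $\alpha_i=0$ otherwise, and $\omega=1$ if $q$ is odd and $\omega=0$ otherwise; $n_r=1$ if $q=2(p-1)p^{r-1}k-1$ for some $k$, and $n_r=0$ otherwise.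
   Context: $\mathbb{Z}_m$ is the cyclic group of order $m$; $[\cdot]$ is the integer part; $(k,p)$ is the greatest common divisor; $\bigoplus_{k}B$ denotes the direct sum of $k$ copies of $B$. For a group $K$, $\mathrm{Hol}(K)$ is the group of pairs $(f,x)$, $f\in\mathrm{Aut}(K)$, $x\in K$, with multiplication $(f,x)(g,y)=(fg,g^{-1}(x)y)$. Homology is with trivial integer coefficients. *)

(* Defs.v *)
From HB Require Import structures.
From mathcomp Require Import all_boot all_order all_fingroup all_algebra.
From mathcomp Require Import boolp zify.

Set Implicit Arguments.
Unset Strict Implicit.
Unset Printing Implicit Defensive.

Import GRing.Theory.
Local Open Scope ring_scope.

Section Holomorph.
Variable K : finGroupType.

Definition aut_of : finGroupType := subg_of [group of Aut [set: K]].

Record hol := Hol { hol_aut : aut_of; hol_elt : K }.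

Definition hol_pair (u : hol) := (hol_aut u, hol_elt u).
Definition pair_hol (u : aut_of * K) := Hol u.1 u.2.
Lemma hol_pairK : cancel hol_pair pair_hol. Proof. by case. Qed.
HB.instance Definition _ := Finite.copy hol (can_type hol_pairK).

(* The product of {perm K} composes from left to right, (s * t) x = t (s x),
   so the composite f \o g (apply g, then f) is g * f. *)
Definition aut_comp (f g : aut_of) : aut_of := (g * f)%g.
Definition aut_app (f : aut_of) (x : K) : K := sgval f x.

Definition hol_one : hol := Hol 1%g 1%g.
Definition hol_mul (u v : hol) : hol :=
  let: Hol f x := u in let: Hol g y := v in
  Hol (aut_comp f g) (aut_app g^-1%g x * y)%g.
Definition hol_inv (u : hol) : hol :=
  let: Hol f x := u in Hol f^-1%g (aut_app f x^-1%g).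

Lemma aut_app1 x : aut_app 1%g x = x.
Proof. exact: perm1. Qed.

Lemma aut_app_comp f g x : aut_app (aut_comp f g) x = aut_app f (aut_app g x).
Proof. exact: permM. Qed.

Lemma aut_appM f : {morph aut_app f : x y / (x * y)%g}.
Proof.
by move=> x y; have /setIdP[_ /morphicP] := subgP f; apply; rewrite inE.
Qed.

Lemma hol_mulA : associative hol_mul.
Proof.
case=> f x [g y] [h z]; rewrite /hol_mul /aut_comp aut_appM !mulgA.
by rewrite invMg -[(g^-1 * h^-1)%g]/(aut_comp h^-1%g g^-1%g) aut_app_comp.
Qed.

Lemma hol_mul1 : left_id hol_one hol_mul.
Proof.
case=> f x; rewrite /hol_mul /hol_one /aut_comp mulg1; congr Hol.
suff -> : aut_app f^-1%g 1%g = 1%g by rewrite mul1g.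
by apply: (@mulgI _ (aut_app f^-1%g 1%g)); rewrite -aut_appM !mulg1.
Qed.

Lemma hol_mulV : left_inverse hol_one hol_inv hol_mul.
Proof.
case=> f x; rewrite /hol_mul /hol_inv /aut_comp mulgV; congr Hol.
by rewrite -aut_app_comp /aut_comp mulgV aut_app1 mulVg.
Qed.

HB.instance Definition _ :=
  Finite_isGroup.Build hol hol_mulA hol_mul1 hol_mulV.

End Holomorph.

(* Homology with trivial integer coefficients is computed from the inhomogeneous
   bar complex. *)

Section GroupHomology.
Variable G : finGroupType.

(* The free abelian group on G^n: c represents \sum_t c t [t_1|...|t_n]. *)
Definition chain n := {ffun n.-tuple G -> int}.
HB.instance Definition _ n := GRing.Zmodule.on (chain n).

(* Entry by entry description of the faces of [t_1|...|t_(n+1)]: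
   face 0 t     = [t_2|...|t_(n+1)],
   face i t     = [t_1|...|t_i * t_(i+1)|...|t_(n+1)]   for 0 < i < n+1,
   face (n+1) t = [t_1|...|t_n]. *)
Definition face n (i : 'I_n.+2) (t : n.+1.-tuple G) : n.-tuple G :=
  [tuple (let a := tnth t (widen_ord (leqnSn n) j) in
          let b := tnth t (lift ord0 j) in
          if (j.+1 < i)%N then a else if j.+1 == i then (a * b)%g else b)
   | j < n].

Definition bar_d n (c : chain n.+1) : chain n :=
  [ffun s => \sum_t \sum_(i < n.+2 | face i t == s) (-1) ^+ i * c t].

Lemma bar_d_is_zmod_morphism n : zmod_morphism (@bar_d n).
Proof.
move=> c d; apply/ffunP=> s; rewrite !ffunE -sumrB; apply: eq_bigr => t _.
by rewrite -sumrB; apply: eq_bigr => i _; rewrite !ffunE mulrBr.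
Qed.
HB.instance Definition _ n :=
  GRing.isZmodMorphism.Build (chain n.+1) (chain n) (@bar_d n)
    (@bar_d_is_zmod_morphism n).

Lemma tnth_face n (i : 'I_n.+2) (t : n.+1.-tuple G) (j : 'I_n) :
  tnth (face i t) j =
  let a := nth 1%g t j in let b := nth 1%g t j.+1 in
  if (j.+1 < i)%N then a else if j.+1 == i then (a * b)%g else b.
Proof. by rewrite tnth_mktuple !(tnth_nth 1%g). Qed.

Lemma face_face n (i : 'I_n.+2) (j : 'I_n.+3) (i' : 'I_n.+3) (j' : 'I_n.+2)
    (t : n.+2.-tuple G) :
  (i < j)%N -> i' = i :> nat -> j = j'.+1 :> nat ->
  face i (face j t) = face j' (face i' t).
Proof.
move=> ij Ei Ej; apply: eq_from_tnth => k; rewrite !tnth_face /=.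
have nthF (h : 'I_n.+3) m : (m < n.+1)%N -> nth 1%g (face h t) m =
    let a := nth 1%g t m in let b := nth 1%g t m.+1 in
    if (m.+1 < h)%N then a else if m.+1 == h then (a * b)%g else b.
  by move=> lt_m; rewrite -(tnth_nth 1%g (face h t) (Ordinal lt_m)) tnth_face.
have lt_k := ltn_ord k; rewrite !nthF ?ltnS ?(ltnW lt_k) //= Ei Ej.
rewrite {}Ej in ij; move: (nat_of_ord i) (nat_of_ord j') (nat_of_ord k) ij.
move=> a b m ab {nthF Ei lt_k}.
by do ![case: ifP => /=]; move=> *; try lia; rewrite ?mulgA.
Qed.

Lemma bar_dd n (c : chain n.+2) : bar_d (bar_d c) = 0.
Proof.
apply/ffunP=> s; rewrite !ffunE.
pose I := ('I_n.+2 * 'I_n.+3)%type.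
pose F u (p : I) : int := (-1) ^+ (p.1 + p.2) * c u.
pose P u (p : I) := face p.1 (face p.2 u) == s.
transitivity (\sum_u \sum_(p | P u p) F u p).
  rewrite (exchange_big_dep xpredT) //=.
  under [RHS]eq_bigr => u _ do rewrite -(pair_big_dep xpredT
    (fun i j => face i (face j u) == s) (fun i j => F u (i, j))) /=.
  rewrite [RHS]exchange_big /=; apply: eq_bigr => i _.
  under eq_bigr => t _ do rewrite ffunE big_distrr /=.
  rewrite exchange_big /=; apply: eq_bigr => u _.
  under eq_bigr => t _ do rewrite big_distrr /=.
  rewrite (exchange_big_dep (fun j => face i (face j u) == s)) /=; last first.
    by move=> t j /eqP ft /eqP fu; rewrite fu ft.
  apply: eq_bigr => j /eqP fs.
  rewrite (big_pred1 (face j u)) => [|t]; first by rewrite /F /= exprD mulrA.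
  rewrite /= [t == _]eq_sym; case: (eqVneq (face j u) t) => [<-|_]; last by rewrite andbF.
  by rewrite fs eqxx.
apply: big1 => u _; rewrite (bigID (fun p : I => p.1 < p.2)%N) /=.
pose f (p : I) : I :=
  if (p.1 < p.2)%N then (inord p.2.-1, inord p.1) else (inord p.2, inord p.1.+1).
have fK : involutive f.
  move=> [i j]; have := ltn_ord i; have := ltn_ord j; rewrite /f /=.
  case: (ltnP i j) => ij lt_j lt_i /=; rewrite !inordK; try lia.
    rewrite ifN; last lia.
    by congr (_, _); apply/val_inj; rewrite /= inordK; lia.
  rewrite ifT; last lia.
  by congr (_, _); apply/val_inj; rewrite /= inordK; lia.
have fP (p : I) : (p.1 < p.2)%N -> P u (f p) = P u p.
  move=> ij; rewrite /P /f ij /=; have := ltn_ord p.1; have := ltn_ord p.2.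
  move=> lt_j lt_i.
  by rewrite (@face_face _ p.1 p.2 (inord p.1) (inord p.2.-1)) // inordK; lia.
have fF (p : I) : (p.1 < p.2)%N -> F u (f p) = - F u p.
  move=> ij; rewrite /F /f ij /= -mulNr; congr (_ * _).
  have := ltn_ord p.1; have := ltn_ord p.2 => lt_j lt_i.
  rewrite !inordK; try lia.
  have -> : (p.1 + p.2 = (p.2.-1 + p.1).+1)%N by lia.
  by rewrite exprS mulN1r opprK.
have flt (p : I) : ((f p).1 < (f p).2)%N = ~~ (p.1 < p.2)%N.
  have := ltn_ord p.1; have := ltn_ord p.2; rewrite /f.
  by case: (ltnP p.1 p.2) => /= ij lt_j lt_i; rewrite !inordK; lia.
rewrite [X in _ + X](reindex_inj (inv_inj fK)) /=.
rewrite [X in _ + X](eq_bigl (fun p : I => P u p && (p.1 < p.2)%N)) /= => [|p]; last first.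
  rewrite flt negbK; case: ltnP => [/fP->|] //.
  by rewrite !andbF.
by rewrite -big_split big1 //= => p /andP[_ /fF->]; rewrite subrr.
Qed.

Definition is_cycle n : {pred chain n} :=
  match n with 0 => predT | m.+1 => fun c => bar_d c == 0 end.

Lemma is_cycle_zmod_closed n : zmod_closed (@is_cycle n).
Proof.
case: n => [|n]; split=> //.
  by rewrite unfold_in /= raddf0.
move=> c d /eqP dc /eqP dd.
by rewrite unfold_in /= raddfB /= dc dd subr0.
Qed.
HB.instance Definition _ n :=
  GRing.isZmodClosed.Build (chain n) (@is_cycle n) (@is_cycle_zmod_closed n).

Record cycle n := Cycle { cycle_val :> chain n; _ : is_cycle cycle_val }.
HB.instance Definition _ n := [isSub for @cycle_val n].
HB.instance Definition _ n := [Choice of cycle n by <:].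
HB.instance Definition _ n := [SubChoice_isSubZmodule of cycle n by <:].

Definition is_boundary n : {pred cycle n} := fun c =>
  `[< exists b : chain n.+1, bar_d b = c :> chain n >].

Lemma is_boundary_zmod_closed n : zmod_closed (@is_boundary n).
Proof.
split=> [|c d]; first by apply/asboolP; exists 0; rewrite raddf0.
move=> /asboolP[b bc] /asboolP[e ed]; apply/asboolP; exists (b - e).
by rewrite raddfB /= bc ed.
Qed.
HB.instance Definition _ n :=
  GRing.isZmodClosed.Build (cycle n) (@is_boundary n)
    (@is_boundary_zmod_closed n).

Definition homology n : zmodType := Quotient.quot (@is_boundary n).

End GroupHomology.

Section DirectSum.
Variables (I : finType) (V : I -> zmodType).

Definition dsum := {dffun forall i, V i}.
HB.instance Definition _ := Choice.on dsum.

Definition dsum_zero : dsum := [ffun i => 0 : V i].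
Definition dsum_opp (u : dsum) : dsum := [ffun i => - u i].
Definition dsum_add (u v : dsum) : dsum := [ffun i => u i + v i].

Lemma dsum_addA : associative dsum_add.
Proof. by move=> u v w; apply/ffunP=> i; rewrite !ffunE addrA. Qed.
Lemma dsum_addC : commutative dsum_add.
Proof. by move=> u v; apply/ffunP=> i; rewrite !ffunE addrC. Qed.
Lemma dsum_add0 : left_id dsum_zero dsum_add.
Proof. by move=> u; apply/ffunP=> i; rewrite !ffunE add0r. Qed.
Lemma dsum_addN : left_inverse dsum_zero dsum_opp dsum_add.
Proof. by move=> u; apply/ffunP=> i; rewrite !ffunE addNr. Qed.

HB.instance Definition _ :=
  GRing.isZmodule.Build dsum dsum_addA dsum_addC dsum_add0 dsum_addN.
End DirectSum.

Definition dcopies (k : nat) (B : zmodType) : zmodType := {ffun 'I_k -> B}.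

Definition zmod_isomorphic (U V : zmodType) : Prop :=
  exists f : {additive U -> V}, bijective f.

(* For p >= 3, r >= 1 and i >= 1 the truncated subtractions below agree
   with those of integers: k > 0, and i |-> q %/ (2 * (p - 1) * p ^ i) is
   nonincreasing. *)
Section Multiplicities.
Local Open Scope nat_scope.

Definition mult1 (p q : nat) : nat :=
  `[< exists k, 0 < k /\ q = 2 * (p - 1) * k - 1 >].

Definition mult2 (p q i : nat) : nat :=
  if i == 1 then
    q %/ (2 * (p - 1) * p)
    + `[< exists k, [/\ 0 < k, gcdn k p = 1 & q = 2 * (p - 1) * k - 1] >]
    + odd q
  else `[< exists k, 0 < k /\ q = 2 * (p - 1) * p * k - 1 >].

Definition mult3_alpha (p q i : nat) : nat :=
  `[< exists k, [/\ 0 < k, gcdn k p = 1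
                  & q = 2 * (p - 1) * p ^ (i - 1) * k - 1] >].

(* Only meant for r >= 3, where r - 2 and r - 1 are positive. *)
Definition mult3 (p r q i : nat) : nat :=
  if i <= r - 2 then
    q %/ (2 * (p - 1) * p ^ i) - q %/ (2 * (p - 1) * p ^ (i + 1))
    + mult3_alpha p q i
  else if i == r - 1 then
    q %/ (2 * (p - 1) * p ^ (r - 1)) + mult3_alpha p q (r - 1) + odd q
  else `[< exists k, 0 < k /\ q = 2 * (p - 1) * p ^ (r - 1) * k - 1 >].

Definition mult (p r q i : nat) : nat :=
  if r == 1 then mult1 p q
  else if r == 2 then mult2 p q i
  else mult3 p r q i.

End Multiplicities.

(* Main.v *)
(* The holomorph is the semidirect product of <x> = Z_m, m = p^r, by a cyclic
   group <s> of order n = p^(r-1) (p-1), where x s = s x^u for a primitive root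
   u modulo m. Put T = x - 1, N = 1 + x + ... + x^(m-1) and
   [u] = 1 + x + ... + x^(u-1) in the integral group ring. The periodic
   resolution of <x> (differentials T and N in turn) is extended to the whole
   group by a total complex in the sense of Wall. Lifting the action of s to
   theta_j = s [u]^j in both degrees 2j-1 and 2j gives
   theta_j^n = 1 + a_j N with a_j = (u^(nj) - 1)/m, so the homotopy between the
   n-th power and the identity can be taken to be multiplication by a_j from
   degree 2j-1 to degree 2j and zero from even degrees; it commutes with the
   action and has square zero, hence no higher homotopies are needed. As these
   homotopies preserve the pairs of rows {2j-1, 2j}, the complex of coinvariants
   splits over j: there are neither differentials nor extension problems, and
   each pair of rows contributes a cyclic group whose order is read off from the
   gcds of u^j - 1 and of 1 + u^j + ... + u^(j(n-1)) with p^r. The comparison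
   theorem transfers the result to the bar complex. *)

From HB Require Import structures.
Require Import Defs.
From mathcomp Require Import all_boot all_order all_fingroup all_algebra all_solvable.
From mathcomp Require Import boolp zify ring.

Set Implicit Arguments.
Unset Strict Implicit.
Unset Printing Implicit Defensive.

Import GRing.Theory.

(** * The integral group ring *)

Section GroupRing.
Local Open Scope ring_scope.
Variable G : finGroupType.

Definition gring := {ffun G -> int}.
HB.instance Definition _ := GRing.Zmodule.on gring.
Implicit Types (a b c : gring) (g h : G).

Definition gr g : gring := [ffun h => (g == h)%:R].
Definition gring_mul a b : gring :=
  [ffun g => \sum_h a h * b (h^-1 * g)%g].

Lemma gring_mulA : associative gring_mul.
Proof.
move=> a b c; apply/ffunP=> g; rewrite !ffunE.
under eq_bigr => h _ do rewrite ffunE big_distrr /=.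
under [RHS]eq_bigr => h _ do rewrite ffunE big_distrl /=.
rewrite [RHS]exchange_big /=; apply: eq_bigr => h _.
rewrite (reindex_inj (mulgI h^-1%g)); apply: eq_bigr => k _ /=.
by rewrite mulrA !invMg invgK !mulgA mulgK.
Qed.

Lemma gring_mul1r : left_id (gr 1%g) gring_mul.
Proof.
move=> a; apply/ffunP=> g; rewrite !ffunE (bigD1 1%g) //= big1 => [|h].
  by rewrite ffunE eqxx mul1r invg1 mul1g addr0.
by rewrite ffunE eq_sym => /negPf->; rewrite mul0r.
Qed.

Lemma gring_mulr1 : right_id (gr 1%g) gring_mul.
Proof.
move=> a; apply/ffunP=> g; rewrite !ffunE (bigD1 g) //= big1 => [|h nhg].
  by rewrite ffunE mulVg eqxx mulr1 addr0.
rewrite ffunE eq_sym -eq_mulVg1.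
by rewrite (negPf nhg) mulr0.
Qed.

Lemma gring_mulDl : left_distributive gring_mul +%R.
Proof.
move=> a b c; apply/ffunP=> g; rewrite !ffunE -big_split /=.
by apply: eq_bigr => h _; rewrite ffunE mulrDl.
Qed.

Lemma gring_mulDr : right_distributive gring_mul +%R.
Proof.
move=> a b c; apply/ffunP=> g; rewrite !ffunE -big_split /=.
by apply: eq_bigr => h _; rewrite ffunE mulrDr.
Qed.

Lemma gring_oner_neq0 : gr 1%g != 0.
Proof. by apply/eqP=> /ffunP/(_ 1%g); rewrite !ffunE eqxx. Qed.

HB.instance Definition _ := GRing.Zmodule_isNzRing.Build gring
  gring_mulA gring_mul1r gring_mulr1 gring_mulDl gring_mulDr gring_oner_neq0.

Lemma grM g h : gr (g * h)%g = gr g * gr h.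
Proof.
apply/ffunP=> k; rewrite !ffunE (bigD1 g) //= big1 => [|l].
  by rewrite !ffunE eqxx mul1r addr0 eq_mulVg1 (eq_mulVg1 h) invMg mulgA.
by rewrite ffunE eq_sym => /negPf->; rewrite mul0r.
Qed.

Lemma grX g n : gr (g ^+ n)%g = gr g ^+ n.
Proof. by elim: n => // n IHn; rewrite expgS exprS grM IHn. Qed.

Lemma gring_sum a : a = \sum_g gr g *~ a g.
Proof.
apply/ffunP=> h; rewrite sum_ffunE (bigD1 h) //= big1 => [|g].
  by rewrite ffunMzE ffunE eqxx addr0 intz.
by rewrite ffunMzE ffunE => /negPf->; rewrite mul0rz.
Qed.

Lemma gring_mulrn_inj k : (0 < k)%N -> injective (fun a => a *+ k).
Proof.
move=> k_gt0 a b ab; apply/ffunP=> g; have /ffunP/(_ g) := ab.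
by rewrite !ffunMnE; apply: Num.Theory.pmulrnI.
Qed.

Definition gring_aug a : int := \sum_g a g.

Lemma gring_aug_is_zmod_morphism : zmod_morphism gring_aug.
Proof.
by move=> a b; rewrite /gring_aug -sumrB; apply: eq_bigr => g _; rewrite !ffunE.
Qed.

HB.instance Definition _ :=
  GRing.isZmodMorphism.Build gring int gring_aug gring_aug_is_zmod_morphism.

Lemma gring_aug_gr g : gring_aug (gr g) = 1.
Proof.
rewrite /gring_aug (bigD1 g) //= big1 => [|h]; first by rewrite ffunE eqxx addr0.
by rewrite ffunE eq_sym => /negPf->.
Qed.

Lemma gring_aug_is_monoid_morphism : monoid_morphism gring_aug.
Proof.
split=> [|a b]; first exact: gring_aug_gr.
rewrite [a in LHS]gring_sum [b in LHS]gring_sum mulr_suml raddf_sum /=.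
rewrite {2}/gring_aug mulr_suml; apply: eq_bigr => g _.
rewrite mulr_sumr raddf_sum mulr_sumr; apply: eq_bigr => h _.
by rewrite mulrzAl mulrzAr -grM !raddfMz /= gring_aug_gr -mulrzA intz mulrC.
Qed.

HB.instance Definition _ :=
  GRing.isMonoidMorphism.Build gring int gring_aug gring_aug_is_monoid_morphism.

Lemma gring_augM a b : gring_aug (a * b) = gring_aug a * gring_aug b.
Proof. exact: rmorphM. Qed.

Lemma gring_augD a b : gring_aug (a + b) = gring_aug a + gring_aug b.
Proof. exact: raddfD. Qed.

Lemma gring_augX a k : gring_aug (a ^+ k) = gring_aug a ^+ k.
Proof. exact: rmorphXn. Qed.

Section Linear.
Variables (V : zmodType) (F : G -> V).

Definition gring_lin a : V := \sum_g F g *~ a g.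

Lemma gring_lin_is_zmod_morphism : zmod_morphism gring_lin.
Proof.
move=> a b; rewrite /gring_lin -sumrB; apply: eq_bigr => g _.
by rewrite !ffunE mulrzBr.
Qed.

HB.instance Definition _ :=
  GRing.isZmodMorphism.Build gring V gring_lin gring_lin_is_zmod_morphism.

Lemma gring_lin_gr g : gring_lin (gr g) = F g.
Proof.
rewrite /gring_lin (bigD1 g) //= big1 => [|h]; first by rewrite ffunE eqxx addr0.
by rewrite ffunE eq_sym => /negPf->.
Qed.

End Linear.

Lemma gring_ind (V : zmodType) (f h : {additive gring -> V}) :
  (forall g, f (gr g) = h (gr g)) -> f =1 h.
Proof.
move=> fh a; rewrite [a]gring_sum !raddf_sum; apply: eq_bigr => g _.
by rewrite !raddfMz fh.
Qed.

End GroupRing.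

(** * Comparison of free resolutions *)

(** Chain maps and homotopies are built degree by degree; [Q] is the invariant that makes the next
    choice possible. *)
Lemma dependent_choice_from (T : nat -> Type) (P : forall n, T n -> T n.+1 -> Prop)
    (Q : forall n, T n -> Prop) (x0 : T 0) :
  Q 0 x0 -> (forall n x, Q n x -> exists2 y, P n x y & Q n.+1 y) ->
  exists2 f : forall n, T n, f 0 = x0 & forall n, P n (f n) (f n.+1).
Proof.
move=> Q0 step.
have next n (x : {x : T n | Q n x}) : {y : {y : T n.+1 | Q n.+1 y} | P n (sval x) (sval y)}.
  apply: cid; case: x => x Qx; have [y Pxy Qy] := step n x Qx.
  by exists (exist _ y Qy).
pose F := nat_rect (fun n => {x : T n | Q n x}) (exist _ x0 Q0) (fun n x => sval (next n x)).
exists (fun n => sval (F n)) => // n.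
exact: (svalP (next n (F n))).
Qed.

Section Resolutions.
Local Open Scope ring_scope.
Variables (R : nzRingType) (aug : {rmorphism R -> int}).

Definition row_aug k (v : 'rV[R]_k) : int := \sum_j aug (v 0 j).

Lemma row_aug_is_zmod_morphism k : zmod_morphism (@row_aug k).
Proof.
move=> v w; rewrite /row_aug -sumrB; apply: eq_bigr => j _.
by rewrite !mxE raddfB.
Qed.
HB.instance Definition _ k :=
  GRing.isZmodMorphism.Build 'rV[R]_k int (@row_aug k) (@row_aug_is_zmod_morphism k).

(* Free modules are modules of row vectors, and a linear map acts by
   multiplication on the right by its matrix. *)
Record resolution := Resolution {
  rk : nat -> nat;
  dif : forall n, 'M[R]_(rk n.+1, rk n);
  rk0 : rk 0 = 1%N;
  dif_dif : forall n, dif n.+1 *m dif n = 0;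
  dif_exact : forall n (v : 'rV_(rk n.+1)),
    v *m dif n = 0 -> exists w, v = w *m dif n.+1;
  row_aug_dif : forall v, row_aug (v *m dif 0%N) = 0;
  row_aug_exact : forall v : 'rV_(rk 0), row_aug v = 0 -> exists w, v = w *m dif 0%N }.

(** Free modules are projective: a preimage is chosen for each row. *)
Lemma lift_rows m k l (A : 'M[R]_(l, k)) (P : 'rV[R]_k -> Prop) (M : 'M[R]_(m, k)) :
  (forall v, P v -> exists w, v = w *m A) -> (forall i, P (row i M)) ->
  exists W, M = W *m A.
Proof.
move=> PA PM; have /choice[w wE] i := PA _ (PM i).
exists (\matrix_i w i); apply/row_matrixP=> i.
by rewrite row_mul rowK wE.
Qed.

Lemma lift_dif (P : resolution) n m (M : 'M_(m, rk P n.+1)) :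
  M *m dif P n = 0 -> exists W, M = W *m dif P n.+1.
Proof.
move=> M0; apply: lift_rows (@dif_exact P n) _ => i.
by rewrite -row_mul M0 row0.
Qed.

(** In degree 0 all modules have rank 1, but only up to a propositional equality, so the all-ones
    matrix stands for the identity; the factor it produces disappears by [mulrn_rk0]. *)
Lemma row_aug_const1 k l (v : 'rV_k) : row_aug (v *m const_mx 1 : 'rV_l) = row_aug v *+ l.
Proof.
rewrite /row_aug -[l in RHS]card_ord -sumr_const; apply: eq_bigr => j _.
rewrite mxE raddf_sum; apply: eq_bigr => i _.
by rewrite mxE mulr1.
Qed.

Lemma mulrn_rk0 (P : resolution) (V : nmodType) (x : V) : x *+ rk P 0 = x.
Proof. by rewrite rk0. Qed.

Lemma comparison_map (P Q : resolution) :
  exists2 f : forall n, 'M[R]_(rk P n, rk Q n), f 0%N = const_mx 1 &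
    forall n, f n.+1 *m dif Q n = dif P n *m f n.
Proof.
apply: (dependent_choice_from
  (P := fun n (x : 'M[R]_(rk P n, rk Q n)) y => y *m dif Q n = dif P n *m x)
  (Q := fun n x => exists y, dif P n *m x = y *m dif Q n)).
  apply: lift_rows (@row_aug_exact Q) _ => i.
  by rewrite row_mul row_aug_const1 rowE row_aug_dif mul0rn.
move=> n x [y yE]; exists y => //.
by apply: lift_dif; rewrite -mulmxA -yE mulmxA dif_dif mul0mx.
Qed.

(** The defect [f n.+1 - dif P n *m h n] is a cycle, so exactness lifts it to give [h n.+1]; the
    augmentation hypothesis starts the induction. *)
Lemma comparison_homotopy (P : resolution) (f : forall n, 'M[R]_(rk P n)) :
  (forall v, row_aug (v *m f 0%N) = 0) ->
  (forall n, f n.+1 *m dif P n = dif P n *m f n) ->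
  exists h : forall n, 'M[R]_(rk P n, rk P n.+1),
    forall n, f n.+1 = dif P n *m h n + h n.+1 *m dif P n.+1.
Proof.
move=> f0 fM.
have [h0 h0E] : exists h0, f 0%N = h0 *m dif P 0.
  by apply: lift_rows (@row_aug_exact P) _ => i; rewrite rowE f0.
have [||h _ hE] := dependent_choice_from (x0 := h0)
  (P := fun n (x : 'M[R]_(rk P n, rk P n.+1)) y => f n.+1 = dif P n *m x + y *m dif P n.+1)
  (Q := fun n x => exists y, f n.+1 = dif P n *m x + y *m dif P n.+1); last by exists h.
  have [|y yE] := @lift_dif P 0%N _ (f 1%N - dif P 0 *m h0).
    by rewrite mulmxBl fM h0E mulmxA subrr.
  by exists y; rewrite -yE addrC subrK.
move=> n x [y yE]; exists y => //.
have [|z zE] := @lift_dif P n.+1 _ (f n.+2 - dif P n.+1 *m y).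
  by rewrite mulmxBl fM yE mulmxDr !mulmxA dif_dif mul0mx add0r subrr.
by exists z; rewrite -zE addrC subrK.
Qed.

Definition coinv_dif (P : resolution) n : 'M[int]_(rk P n.+1, rk P n) :=
  map_mx aug (dif P n).

Lemma coinv_dif_dif (P : resolution) n : coinv_dif P n.+1 *m coinv_dif P n = 0.
Proof. by rewrite -map_mxM dif_dif map_mx0. Qed.

(* [A] is the differential leaving the middle term, [B] the one entering it. *)
Definition computes_homology k l m (A : 'M[int]_(l, k)) (B : 'M[int]_(m, l))
    (V : zmodType) (f : 'rV[int]_l -> V) :=
  [/\ forall v w, v *m A = 0 -> w *m A = 0 -> f (v - w) = f v - f w,
      forall x, exists2 v, v *m A = 0 & f v = x &
      forall v, v *m A = 0 -> f v = 0 <-> exists w, v = w *m B].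

(** The comparison maps in the two directions are inverse up to homotopy, and the homotopies survive
    the passage to coinvariants; [f] is pulled back along the map from [P] to [Q]. *)
Lemma comparison_homology (P Q : resolution) n (V : zmodType) f :
  computes_homology (coinv_dif Q n) (coinv_dif Q n.+1) (V := V) f ->
  exists g, computes_homology (coinv_dif P n) (coinv_dif P n.+1) (V := V) g.
Proof.
case=> fB f_surj f_ker.
have [a a0 aM] := comparison_map P Q; have [b b0 bM] := comparison_map Q P.
have ab0 v : row_aug (v *m (a 0%N *m b 0%N - 1%:M)) = 0.
  by rewrite mulmxBr mulmx1 raddfB /= a0 b0 mulmxA !row_aug_const1 !mulrn_rk0 subrr.
have ba0 v : row_aug (v *m (b 0%N *m a 0%N - 1%:M)) = 0.
  by rewrite mulmxBr mulmx1 raddfB /= a0 b0 mulmxA !row_aug_const1 !mulrn_rk0 subrr.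
have [|h hE] := comparison_homotopy (f := fun n => a n *m b n - 1%:M) ab0.
  by move=> k; rewrite mulmxBl mulmxBr -mulmxA bM mulmxA aM mulmxA mulmx1 mul1mx.
have [|l lE] := comparison_homotopy (f := fun n => b n *m a n - 1%:M) ba0.
  by move=> k; rewrite mulmxBl mulmxBr -mulmxA aM mulmxA bM mulmxA mulmx1 mul1mx.
pose A k := map_mx aug (a k); pose B k := map_mx aug (b k).
have AM k : A k.+1 *m coinv_dif Q k = coinv_dif P k *m A k by rewrite -!map_mxM aM.
have BM k : B k.+1 *m coinv_dif P k = coinv_dif Q k *m B k by rewrite -!map_mxM bM.
have AB k : A k.+1 *m B k.+1 = 1%:M + coinv_dif P k *m map_mx aug (h k)
     + map_mx aug (h k.+1) *m coinv_dif P k.+1.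
  rewrite -addrA -!map_mxM -[1%:M](map_mx1 aug) -!map_mxD -hE addrC subrK //.
have BA k : B k.+1 *m A k.+1 = 1%:M + coinv_dif Q k *m map_mx aug (l k)
     + map_mx aug (l k.+1) *m coinv_dif Q k.+1.
  rewrite -addrA -!map_mxM -[1%:M](map_mx1 aug) -!map_mxD -lE addrC subrK //.
have A0 v : v *m coinv_dif P n = 0 -> v *m A n.+1 *m coinv_dif Q n = 0.
  by move=> v0; rewrite -mulmxA AM mulmxA v0 mul0mx.
have B0 v : v *m coinv_dif Q n = 0 -> v *m B n.+1 *m coinv_dif P n = 0.
  by move=> v0; rewrite -mulmxA BM mulmxA v0 mul0mx.
exists (fun v => f (v *m A n.+1)); split.
- by move=> v w /A0 v0 /A0 w0; rewrite mulmxBl fB.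
- move=> x; have [v v0 <-] := f_surj x; exists (v *m B n.+1); first exact: B0.
  rewrite -mulmxA BA !mulmxDr mulmx1 !mulmxA v0 mul0mx addr0.
  (* The homotopy leaves a boundary, on which [f] vanishes. Additivity of [f] is only given for
     differences of cycles, hence the double negation. *)
  set w := _ *m coinv_dif Q n.+1.
  have w0 : w *m coinv_dif Q n = 0 by rewrite -mulmxA coinv_dif_dif mulmx0.
  rewrite -[w]opprK fB ?mulNmx ?w0 ?oppr0 // -[RHS]subr0; congr (_ - _).
  apply/f_ker; first by rewrite mulNmx w0 oppr0.
  by exists (- (v *m map_mx aug (l n.+1))); rewrite mulNmx.
- move=> v v0; split=> [/(f_ker _ (A0 _ _ v0))[w wE]|[w ->]]; last first.
    apply/f_ker; first by rewrite -!mulmxA AM (mulmxA (coinv_dif P _)) coinv_dif_dif mul0mx mulmx0.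
    by exists (w *m A n.+2); rewrite -!mulmxA AM.
  have := congr1 (mulmx v) (AB n); rewrite mulmxA wE.
  rewrite -mulmxA -BM !mulmxDr mulmx1 !mulmxA v0 mul0mx addr0 => /eqP.
  rewrite -subr_eq => /eqP <-; exists (w *m B n.+2 - v *m map_mx aug (h n.+1)).
  by rewrite mulmxBl.
Qed.

End Resolutions.

(** * The bar resolution *)

Section BarResolution.
Local Open Scope ring_scope.
Variable G : finGroupType.
Local Notation R := (gring G).
Local Notation brk n := #|{: n.-tuple G}|.

(** Dropping the first letter of a bar symbol releases it as a coefficient in the group ring; the
    other faces have coefficient 1. *)
Definition face_coef n (i : 'I_n.+2) (t : n.+1.-tuple G) : G :=
  if i == 0 :> nat then thead t else 1%g.

Definition bar_mx n : 'M[R]_(brk n.+1, brk n) :=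
  \matrix_(k, j) \sum_(i < n.+2 | face i (enum_val k) == enum_val j)
    (-1) ^+ i * gr (face_coef i (enum_val k)).

Definition bar_elt n (g : G) (t : n.-tuple G) : 'rV[R]_(brk n) :=
  gr g *: delta_mx 0 (enum_rank t).

Lemma bar_elt_dif n g (t : n.+1.-tuple G) :
  bar_elt g t *m bar_mx n =
  \sum_(i < n.+2) (-1) ^+ i *: bar_elt (g * face_coef i t)%g (face i t).
Proof.
rewrite -scalemxAl -rowE; apply/rowP=> j; rewrite !mxE summxE enum_rankK.
rewrite big_mkcond big_distrr /=; apply: eq_bigr => i _; rewrite !mxE eqxx /=.
have -> : (j == enum_rank (face i t)) = (face i t == enum_val j).
  by rewrite -(can_eq enum_valK) enum_rankK eq_sym.
case: ifP => _; last by rewrite !mulr0.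
by rewrite mulr1 grM 2!mulrA; congr (_ * _); apply: commr_sign.
Qed.

(** Extension from the Z-basis g[t_1|...|t_n]. It is additive only, since the contracting homotopy
    is not equivariant. *)
Definition bar_lin (V : zmodType) n (F : G -> n.-tuple G -> V) (v : 'rV[R]_(brk n)) : V :=
  \sum_t gring_lin (F^~ t) (v 0 (enum_rank t)).

Lemma bar_lin_is_zmod_morphism V n F : zmod_morphism (@bar_lin V n F).
Proof.
move=> v w; rewrite /bar_lin -sumrB; apply: eq_bigr => t _.
by rewrite !mxE raddfB.
Qed.
HB.instance Definition _ V n F :=
  GRing.isZmodMorphism.Build 'rV[R]_(brk n) V (@bar_lin V n F)
    (@bar_lin_is_zmod_morphism V n F).

Lemma bar_lin_elt V n F g t : @bar_lin V n F (bar_elt g t) = F g t.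
Proof.
rewrite /bar_lin (bigD1 t) //= big1 => [|s st]; rewrite !mxE.
  by rewrite !eqxx mulr1 addr0 gring_lin_gr.
by rewrite (inj_eq enum_rank_inj) (negPf st) mulr0 raddf0.
Qed.

Lemma bar_ind (V : zmodType) n (f h : {additive 'rV[R]_(brk n) -> V}) :
  (forall g t, f (bar_elt g t) = h (bar_elt g t)) -> f =1 h.
Proof.
move=> fh v; rewrite [v]row_sum_delta !raddf_sum; apply: eq_bigr => j _.
rewrite [v 0 j]gring_sum scaler_suml !raddf_sum; apply: eq_bigr => g _.
rewrite -scalerMzl !raddfMz; congr (_ *~ _).
by have := fh g (enum_val j); rewrite /bar_elt enum_valK.
Qed.

Definition bar_htpy n : 'rV[R]_(brk n) -> 'rV[R]_(brk n.+1) :=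
  bar_lin (fun g t => bar_elt 1%g [tuple of g :: t]).
HB.instance Definition _ n :=
  GRing.isZmodMorphism.Build _ _ (@bar_htpy n)
    (@bar_lin_is_zmod_morphism _ n (fun g t => bar_elt 1%g [tuple of g :: t])).

Lemma bar_htpyE n g t : @bar_htpy n (bar_elt g t) = bar_elt 1%g [tuple of g :: t].
Proof. exact: bar_lin_elt. Qed.

Lemma face0_cons n g (t : n.-tuple G) : face ord0 [tuple of g :: t] = t.
Proof. by apply: eq_from_tnth => j; rewrite tnth_face /= (tnth_nth 1%g). Qed.

Lemma face_lift_cons n (i : 'I_n.+2) g (t : n.+1.-tuple G) :
  face (lift ord0 i) [tuple of g :: t] = [tuple of (g * face_coef i t)%g :: face i t].
Proof.
apply: eq_from_tnth => j; rewrite tnth_face !(tnth_nth 1%g) /= /bump add1n.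
case: j => -[|j] ltj /=.
  rewrite ltnS eqSS (eq_sym 0) /face_coef; case: eqP => [->|/eqP]; last first.
    by rewrite lt0n => ->; rewrite mulg1.
  by rewrite ltnn; case/tupleP: t => h t; rewrite theadE.
have ltj' : (j < n)%N by [].
by have := tnth_face i t (Ordinal ltj'); rewrite (tnth_nth 1%g) /= => ->; rewrite ltnS eqSS.
Qed.

(** Face 0 of [g|t_1|...] gives back g[t_1|...], and the other faces are, with opposite sign, the
    homotopy applied to the faces of g[t_1|...]. *)
Lemma bar_htpy_dif n v : bar_htpy v *m bar_mx n.+1 = v - bar_htpy (v *m bar_mx n).
Proof.
apply: (@bar_ind _ _ (mulmxr (bar_mx n.+1) \o @bar_htpy _)
  (idfun \- (@bar_htpy _ \o mulmxr (bar_mx n)))) => g t /=.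
rewrite bar_htpyE !bar_elt_dif big_ord_recl (raddf_sum (@bar_htpy n)) /= scale1r mul1g face0_cons.
rewrite [face_coef ord0 _]theadE -sumrN; congr (_ + _); apply: eq_bigr => i _.
by rewrite (raddfZsign (@bar_htpy n)) /= bar_htpyE face_lift_cons mul1g /bump add1n exprS mulN1r scaleNr.
Qed.

Lemma row_aug_elt n g (t : n.-tuple G) : row_aug (@gring_aug G) (bar_elt g t) = 1.
Proof.
rewrite /row_aug (bigD1 (enum_rank t)) //= big1 => [|i ni]; rewrite !mxE.
  by rewrite !eqxx mulr1 addr0 gring_aug_gr.
by rewrite (negPf ni) mulr0 raddf0.
Qed.

Lemma bar_htpy_dif0 v :
  bar_htpy v *m bar_mx 0 = v - bar_elt 1%g [tuple] *~ row_aug (@gring_aug G) v.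
Proof.
pose c (v : 'rV[R]_(brk 0)) := bar_elt 1%g [tuple] *~ row_aug (@gring_aug G) v.
have cB : zmod_morphism c by move=> x y; rewrite /c raddfB mulrzBr.
pose cA : {additive _ -> _} := HB.pack c (GRing.isZmodMorphism.Build _ _ c cB).
apply: (@bar_ind _ _ (mulmxr (bar_mx 0) \o @bar_htpy _) (idfun \- cA)) => g t /=.
rewrite bar_htpyE bar_elt_dif !big_ord_recl big_ord0 addr0 /= scale1r mul1g face0_cons.
rewrite [face_coef ord0 _]theadE expr1 scaleN1r mulg1; congr (_ - _).
by rewrite /c row_aug_elt (tuple0 (face _ _)).
Qed.

Lemma bar_row_aug v : row_aug (@gring_aug G) (v *m bar_mx 0) = 0.
Proof.
apply: (@bar_ind _ _ (@row_aug _ _ _ \o mulmxr (bar_mx 0)) \0) => g t /=.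
rewrite bar_elt_dif !big_ord_recl big_ord0 addr0 /= scale1r scaleN1r raddfB /=.
by rewrite !row_aug_elt subrr.
Qed.

(** Derived from the contraction h instead of the simplicial identities: every generator is a group
    element times a value of h, and (h v) d d = v d - (v d - h (v d d)) = h (v d d), which vanishes
    by induction. *)
Lemma bar_dif_dif n : bar_mx n.+1 *m bar_mx n = 0.
Proof.
have ext m k (A : 'M[R]_(brk m, k)) : (forall g t, bar_elt g t *m A = 0) -> A = 0.
  move=> A0; apply/row_matrixP=> i; rewrite row0 rowE.
  by have := A0 1%g (enum_val i); rewrite /bar_elt enum_valK scale1r.
elim: n => [|n IHn]; apply: ext => g t; case/tupleP: t => h t.
  have -> : bar_elt g [tuple of h :: t] = gr g *: bar_htpy (bar_elt h t).
    by rewrite bar_htpyE /bar_elt scale1r.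
  rewrite mulmxA -!scalemxAl bar_htpy_dif mulmxBl bar_htpy_dif0 bar_row_aug.
  by rewrite subr0 subrr scaler0.
have -> : bar_elt g [tuple of h :: t] = gr g *: bar_htpy (bar_elt h t).
  by rewrite bar_htpyE /bar_elt scale1r.
rewrite mulmxA -!scalemxAl bar_htpy_dif mulmxBl bar_htpy_dif.
by rewrite -mulmxA IHn mulmx0 raddf0 subr0 subrr scaler0.
Qed.

Lemma bar_exact n (v : 'rV[R]_(brk n.+1)) :
  v *m bar_mx n = 0 -> exists w, v = w *m bar_mx n.+1.
Proof. by move=> v0; exists (bar_htpy v); rewrite bar_htpy_dif v0 raddf0 subr0. Qed.

Lemma bar_row_aug_exact (v : 'rV[R]_(brk 0)) :
  row_aug (@gring_aug G) v = 0 -> exists w, v = w *m bar_mx 0.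
Proof. by move=> v0; exists (bar_htpy v); rewrite bar_htpy_dif0 v0 mulr0z subr0. Qed.

Lemma bar_rk0 : brk 0 = 1%N.
Proof. by rewrite card_tuple expn0. Qed.

Definition bar_resolution : resolution (@gring_aug G) :=
  Resolution bar_rk0 bar_dif_dif bar_exact bar_row_aug bar_row_aug_exact.

Lemma gring_aug_sign_gr k (g : G) : gring_aug ((-1) ^+ k * gr g) = (-1) ^+ k.
Proof. by rewrite rmorphM rmorphXn rmorphN1 /= gring_aug_gr mulr1. Qed.

Definition chain_row n (c : chain G n) : 'rV[int]_(brk n) := \row_j c (enum_val j).
Definition row_chain n (v : 'rV[int]_(brk n)) : chain G n :=
  [ffun t => v 0 (enum_rank t)].

Lemma chain_rowK n : cancel (@chain_row n) (@row_chain n).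
Proof. by move=> c; apply/ffunP=> t; rewrite ffunE mxE enum_rankK. Qed.

Lemma row_chainK n : cancel (@row_chain n) (@chain_row n).
Proof. by move=> v; apply/rowP=> j; rewrite mxE ffunE enum_valK. Qed.

Lemma chain_rowB n (c d : chain G n) : chain_row (c - d) = chain_row c - chain_row d.
Proof. by apply/rowP=> j; rewrite !mxE !ffunE. Qed.

(** The augmentation forgets the coefficient released by face 0, so the coinvariants of the bar
    resolution are the complex that defines homology. *)
Lemma chain_row_bar_d n (c : chain G n.+1) :
  chain_row (bar_d c) = chain_row c *m coinv_dif bar_resolution n.
Proof.
apply/rowP=> j; rewrite !mxE ffunE (reindex_onto enum_val enum_rank) /= => [|t _]; last exact: enum_rankK.
apply: eq_big => [k|k _]; first by rewrite enum_valK eqxx.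
rewrite !mxE raddf_sum mulr_sumr; apply: eq_bigr => i _.
by rewrite mulrC; congr (_ * _); exact/esym/gring_aug_sign_gr.
Qed.

(** On cycles [f] vanishes exactly on boundaries, so it is well defined and injective on classes;
    its value is read on a chosen representative. *)
Lemma homology_isomorphic n (V : zmodType) f :
  computes_homology (coinv_dif bar_resolution n) (coinv_dif bar_resolution n.+1)
    (V := V) f ->
  zmod_isomorphic (homology G n.+1) V.
Proof.
case=> fB f_surj f_ker.
have row0 : chain_row (0 : chain G n) = 0 by apply/rowP=> j; rewrite !mxE ffunE.
pose r (c : Defs.cycle G n.+1) : 'rV_(brk n.+1) := chain_row (cycle_val c).
have rc c : r c *m coinv_dif bar_resolution n = 0.
  by rewrite -chain_row_bar_d; case: c => c /eqP /= ->.
have rB c d : r (c - d) = r c - r d by rewrite /r -chain_rowB.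
have bdP c : reflect (f (r c) = 0) (is_boundary c).
  apply: (equivP (asboolP _)); rewrite (f_ker _ (rc c)); split=> [[b bE]|[w wE]].
    by exists (chain_row b); rewrite -chain_row_bar_d bE.
  by exists (row_chain w); apply: (can_inj (@chain_rowK _)); rewrite chain_row_bar_d row_chainK -wE.
have piE (c d : Defs.cycle G n.+1) :
  (\pi_(homology G n.+1)%qT c = \pi_(homology G n.+1)%qT d) <-> f (r c) = f (r d).
  have := Quotient.idealrBE (@is_boundary G n.+1) c d.
  rewrite -[_ \in _]/(is_boundary (c - d)) => cdE.
  rewrite (rwP (@eqP _ _ _)) -cdE -(rwP (bdP _)) rB fB //.
  by split=> [/eqP|->]; rewrite ?subrr // subr_eq0 => /eqP.
pose F (x : homology G n.+1) := f (r (generic_quotient.repr x)).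
have F_pi c : F (\pi_(homology G n.+1)%qT c) = f (r c) by apply/piE; rewrite generic_quotient.reprK.
have FB : zmod_morphism F.
  move=> x y; rewrite -[x]generic_quotient.reprK -[y]generic_quotient.reprK -raddfB /= !F_pi rB fB //.
pose FA : {additive homology G n.+1 -> V} :=
  HB.pack F (GRing.isZmodMorphism.Build _ _ F FB).
exists FA.
have /choice[h hE] : forall x, exists c, f (r c) = x.
  move=> x; have [v v0 <-] := f_surj x.
  have cv : is_cycle (row_chain v).
    apply/eqP; apply: (can_inj (@chain_rowK _)).
    by rewrite chain_row_bar_d row_chainK v0 row0.
  by exists (Cycle cv); rewrite /r /= row_chainK.
exists (fun x => \pi_(homology G n.+1)%qT (h x)) => x /=; last by rewrite F_pi hE.
by rewrite -[x in RHS]generic_quotient.reprK; apply/piE; rewrite hE.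
Qed.

End BarResolution.

(** * The total complex of a split metacyclic group *)

Lemma geometric_sumM (R : pzSemiRingType) (y : R) (a b : nat) :
  (\sum_(l < a * b) y ^+ l = (\sum_(l < b) y ^+ l) * \sum_(i < a) (y ^+ b) ^+ i)%R.
Proof.
elim: a => [|a IHa]; first by rewrite !big_ord0 mulr0.
rewrite mulSn addnC big_split_ord /= IHa big_ord_recr /= mulrDr; congr (_ + _)%R.
rewrite mulr_suml; apply: eq_bigr => l _.
by rewrite -exprM -exprD mulnC addnC.
Qed.

Section Tridiagonal.
Local Open Scope ring_scope.

(** The coefficients depend on the row, that is on the generator being differentiated: d0 lowers its
    index by one, d1 keeps it, d2 raises it. *)
Definition tridiag (R : pzRingType) (d0 d1 d2 : nat -> R) (k l : nat) : 'M[R]_(k, l) :=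
  \matrix_(i, j) (d0 i *+ (i == j.+1 :> nat) + d1 i *+ (i == j :> nat)
                  + d2 i *+ (i.+1 == j :> nat)).

Lemma sum_mulrb (V : nmodType) k (f : nat -> V) i : (i < k)%N ->
  \sum_(j < k) f j *+ (j == i :> nat) = f i.
Proof.
move=> ltik; rewrite (bigD1 (Ordinal ltik)) //= big1 => [|j nj].
  by rewrite eqxx mulr1n addr0.
by case: eqP => // e; case/eqP: nj; apply: val_inj.
Qed.

Lemma row_mul_tridiag (R : pzRingType) (d0 d1 d2 : nat -> R) k (f : nat -> R) (j : 'I_k) :
  ((\row_(i < k.+1) f i) *m tridiag d0 d1 d2 k.+1 k) 0 j =
  f j.+1 * d0 j.+1 + f j * d1 j + (if nat_of_ord j is j'.+1 then f j' * d2 j' else 0).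
Proof.
have ltj := ltn_ord j.
rewrite mxE.
under eq_bigr => i _ do rewrite !mxE !mulrDr !mulrnAr.
rewrite !big_split /=; congr (_ + _ + _).
- by rewrite (@sum_mulrb _ _ (fun i => f i * d0 i)).
- by rewrite (@sum_mulrb _ _ (fun i => f i * d1 i)) // ltnW.
case: (nat_of_ord j) ltj => [|j'] ltj; first by rewrite big1.
by rewrite (@sum_mulrb _ _ (fun i => f i * d2 i)) // ltnW // ltnW.
Qed.

Lemma map_tridiag (R R' : pzRingType) (h : {rmorphism R -> R'}) d0 d1 d2 k l :
  map_mx h (tridiag d0 d1 d2 k l) = tridiag (h \o d0) (h \o d1) (h \o d2) k l.
Proof. by apply/matrixP=> i j; rewrite !mxE !raddfD !raddfMn. Qed.

Lemma row_inord (R : Type) k (v : 'rV[R]_k.+1) : v = \row_(j < k.+1) v 0 (inord j).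
Proof. by apply/rowP=> j; rewrite mxE inord_val. Qed.

End Tridiagonal.

Section Wall.
Local Open Scope ring_scope.
(** [iS] and [kX] return the reduced exponents of the normal form s^i x^k, whose uniqueness they
    encode; thus G has order m n. *)
Variables (G : finGroupType) (x s : G) (m n u c : nat) (iS kX : G -> nat).
Hypotheses (m_gt0 : (0 < m)%N) (n_gt0 : (0 < n)%N) (uE : (u ^ n = 1 + c * m)%N).
Hypotheses (xm : (x ^+ m = 1)%g) (sn : (s ^+ n = 1)%g).
Hypothesis xs : (x * s = s * x ^+ u)%g.
Hypothesis iSE : forall i k, iS (s ^+ i * x ^+ k)%g = (i %% n)%N.
Hypothesis kXE : forall i k, kX (s ^+ i * x ^+ k)%g = (k %% m)%N.
Hypothesis nfE : forall g, (g = s ^+ iS g * x ^+ kX g)%g.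

Local Notation R := (gring G).
Let X : R := gr x.
Let S : R := gr s.
Definition wall_T : R := gr x - 1.
Definition wall_N : R := \sum_(k < m) gr x ^+ k.
Definition wall_U : R := \sum_(k < u) gr x ^+ k.
Definition wall_theta j : R := gr s * wall_U ^+ j.
(** This is (u^(n j) - 1)/m without a division: c is (u^n - 1)/m and the geometric sum does the
    rest. *)
Definition wall_a j : nat := ((\sum_(i < j) (u ^ n) ^ i) * c)%N.
(** The two alternating differentials of a cyclic group of order n, with the generator replaced by
    its twisted lift. *)
Definition wall_delta (b : bool) j : R :=
  if b then wall_theta j - 1 else \sum_(l < n) wall_theta j ^+ l.
Local Notation T := wall_T.
Local Notation N := wall_N.
Local Notation U := wall_U.
Local Notation theta := wall_theta.
Local Notation a := wall_a.
Local Notation delta := wall_delta.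

Let Xm : X ^+ m = 1. Proof. by rewrite -grX xm. Qed.
Let Sn : S ^+ n = 1. Proof. by rewrite -grX sn. Qed.
Let XS : X * S = S * X ^+ u. Proof. by rewrite -grX -!grM xs. Qed.

Lemma wall_XkS k : X ^+ k * S = S * (X ^+ u) ^+ k.
Proof.
elim: k => [|k IHk]; first by rewrite mul1r mulr1.
by rewrite exprS -mulrA IHk mulrA XS -mulrA -exprS.
Qed.

Lemma wall_aS j : a j.+1 = (a j + (u ^ n) ^ j * c)%N.
Proof. by rewrite /wall_a big_ord_recr mulnDl. Qed.

Lemma wall_a_eq j : ((u ^ n) ^ j = 1 + a j * m)%N.
Proof.
elim: j => [|j IHj]; first by rewrite /wall_a big_ord0.
by rewrite wall_aS expnS IHj uE; lia.
Qed.

Lemma wall_commUX k : GRing.comm U (X ^+ k).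
Proof. by apply/commr_sym/commr_sum => i _; apply/commr_sym/commrX/commr_sym/commrX. Qed.

Lemma wall_commUN : GRing.comm U N.
Proof. by apply: commr_sum => i _; exact: wall_commUX. Qed.

Lemma wall_UT : U * T = X ^+ u - 1.
Proof. by rewrite subrX1 mulrBr mulr1 mulrBl mul1r -[gr x]expr1 wall_commUX. Qed.

Lemma wall_commUT : GRing.comm U T.
Proof. by rewrite /GRing.comm wall_UT subrX1. Qed.

Lemma wall_TN : T * N = 0.
Proof. by rewrite -subrX1 Xm subrr. Qed.

Lemma wall_NT : N * T = 0.
Proof.
suff <- : T * N = N * T by exact: wall_TN.
rewrite mulrBr mulrBl mulr1 mul1r; congr (_ - _).
by apply: commr_sum => i _; apply: commrX.
Qed.

Lemma wall_NX k : N * X ^+ k = N.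
Proof.
have NX : N * X = N by apply/eqP; rewrite -subr_eq0 -{2}[N]mulr1 -mulrBr wall_NT.
by elim: k => [|k IHk]; rewrite ?mulr1 // exprS mulrA NX.
Qed.

Lemma wall_XN k : X ^+ k * N = N.
Proof. by rewrite -[RHS](wall_NX k); apply: commr_sum => i _; apply/commr_sym/commrX/commr_sym/commrX. Qed.

Lemma wall_NN : N * N = N *+ m.
Proof.
rewrite {1}/wall_N mulr_suml -[m in RHS]card_ord -sumr_const.
by apply: eq_bigr => k _; rewrite wall_XN.
Qed.

(** Moving s across N replaces x by x^u. That the resulting sum N' is again N is shown without
    permuting exponents: m N' and m N both equal N' N, and the group ring is torsion-free. *)
Lemma wall_NS : N * S = S * N.
Proof.
rewrite /wall_N mulr_suml mulr_sumr.
under eq_bigr => k _ do rewrite wall_XkS.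
rewrite -!mulr_sumr; congr (_ * _); set N' := \sum_(i < m) _; rewrite -/N.
have N'u : N' * X ^+ u = N'.
  apply/eqP; rewrite -subr_eq0 -{2}[N']mulr1 -mulrBr.
  have -> : N' * (X ^+ u - 1) = (X ^+ u - 1) * N'.
    rewrite mulrBr mulrBl mulr1 mul1r; congr (_ - _).
    by apply/commr_sym/commr_sum => i _; apply: commrX.
  by rewrite -subrX1 -exprM mulnC exprM Xm expr1n subrr.
(* N' absorbs x^u, hence its powers; as u^n = 1 + c m, it then absorbs x itself. *)
have N'uk k : N' * X ^+ (u ^ k.+1) = N'.
  have N'l l : N' * (X ^+ u) ^+ l = N'.
    by elim: l => [|l IHl]; rewrite ?mulr1 // exprS mulrA N'u.
  by rewrite expnS exprM N'l.
have N'X : N' * X = N'.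
  rewrite -[RHS](N'uk n.-1) prednK // uE exprD mulnC exprM Xm expr1n mulr1.
  by rewrite expr1.
have N'Xk k : N' * X ^+ k = N'.
  by elim: k => [|k IHk]; rewrite ?mulr1 // exprS mulrA N'X.
apply: (gring_mulrn_inj m_gt0) => /=.
transitivity (N' * N).
  rewrite /wall_N mulr_sumr -[m in LHS]card_ord -sumr_const.
  by apply: eq_bigr => k _; rewrite N'Xk.
rewrite /N' mulr_suml -[m in RHS]card_ord -sumr_const.
by apply: eq_bigr => k _; rewrite -exprM wall_XN.
Qed.

Lemma wall_TS : T * S = S * U * T.
Proof. by rewrite -mulrA wall_UT mulrBl mulrBr mul1r mulr1 XS. Qed.

(** As x s - s = s (x^u - 1) = s [u] T, crossing T costs one more factor [u], whereas crossing N
    costs nothing: the index j grows once every two rows. *)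
Lemma wall_Ttheta j : T * theta j = theta j.+1 * T.
Proof.
rewrite /wall_theta mulrA wall_TS exprS !mulrA -!mulrA.
by rewrite (commrX j (commr_sym wall_commUT)).
Qed.

Lemma wall_Ntheta j : N * theta j = theta j * N.
Proof.
rewrite /wall_theta mulrA wall_NS -!mulrA.
by rewrite (commrX j (commr_sym wall_commUN)).
Qed.

(** Moving s leftwards replaces x by x^u in the power sums, and sums of lengths u and u^k then
    multiply to one of length u^(k+1). *)
Lemma wall_theta_exp j k :
  theta j ^+ k = S ^+ k * (\sum_(l < u ^ k) X ^+ l) ^+ j.
Proof.
elim: k => [|k IHk]; first by rewrite big_ord1 expr1n mulr1.
rewrite exprSr IHk /wall_theta -/S.
set V := \sum_(l < u ^ k) _; pose V' := \sum_(l < u ^ k) (X ^+ u) ^+ l.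
have VS : V * S = S * V'.
  rewrite mulr_suml mulr_sumr.
  by apply: eq_bigr => l _; rewrite wall_XkS.
have VjS : V ^+ j * S = S * V' ^+ j.
  elim: j {IHk} => [|j IHj]; first by rewrite mul1r mulr1.
  by rewrite exprS -mulrA IHj mulrA VS -mulrA -exprS.
have UV' : GRing.comm U V'.
  by apply: commr_sum => i _; rewrite -exprM; exact: wall_commUX.
rewrite expnSr geometric_sumM -/V' -/U exprMn_comm // mulrA -[_ * S]mulrA VjS.
rewrite mulrA -exprSr -mulrA; congr (_ * _).
by apply/commrX/commr_sym/commrX.
Qed.

(** A sum of 1 + c m consecutive powers of x runs c times around the cyclic group, giving 1 + c N;
    the j-th power follows from N^2 = m N and the recursion of a_j. *)
Lemma wall_theta_n j : theta j ^+ n = 1 + N *+ a j.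
Proof.
rewrite wall_theta_exp Sn mul1r uE.
have -> : \sum_(l < 1 + c * m) X ^+ l = 1 + N *+ c.
  rewrite addnC big_split_ord /= big_ord1 addn0 mulnC exprM Xm expr1n mulnC.
  rewrite geometric_sumM addrC; congr (_ + _).
  under [X in _ * X]eq_bigr => i _ do rewrite Xm expr1n.
  by rewrite sumr_const card_ord mulr_natr.
elim: j => [|j IHj]; first by rewrite /wall_a big_ord0 mulr0n addr0.
rewrite exprS IHj wall_aS wall_a_eq.
rewrite mulrDl mul1r mulrDr mulr1 mulrnAl mulrnAr wall_NN -!mulrnA.
rewrite -!addrA; congr (_ + _); rewrite -!mulrnDr; congr (_ *+ _).
lia.
Qed.

Lemma wall_Tdelta b j : T * delta b j = delta b j.+1 * T.
Proof.
have TX k : T * theta j ^+ k = theta j.+1 ^+ k * T.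
  elim: k => [|k IHk]; first by rewrite mul1r mulr1.
  by rewrite exprS mulrA wall_Ttheta -mulrA IHk mulrA -exprS.
case: b; rewrite /wall_delta.
  by rewrite mulrBr [RHS]mulrBl mulr1 mul1r wall_Ttheta.
by rewrite mulr_sumr mulr_suml; apply: eq_bigr => k _; rewrite TX.
Qed.

Lemma wall_Ndelta b j : N * delta b j = delta b j * N.
Proof.
case: b; rewrite /wall_delta.
  by rewrite mulrBr [RHS]mulrBl mulr1 mul1r wall_Ntheta.
by apply: commr_sum => k _; apply: commrX; exact: wall_Ntheta.
Qed.

(** The composite would be zero if the lift had order n; its value is the obstruction that the
    homotopy a_j cancels. *)
Lemma wall_delta_delta b j : delta b j * delta (~~ b) j = N *+ a j.
Proof.
have E : (theta j - 1) * (\sum_(l < n) theta j ^+ l) = N *+ a j.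
  by rewrite -subrX1 wall_theta_n addrAC subrr add0r.
case: b => //=; rewrite /wall_delta -E.
rewrite mulrBr mulrBl mulr1 mul1r; congr (_ - _).
by apply/commr_sym/commr_sum => i _; apply: commrX.
Qed.

Let iS_lt g : (iS g < n)%N.
Proof. by rewrite [g]nfE iSE ltn_mod. Qed.

Let kX_lt g : (kX g < m)%N.
Proof. by rewrite [g]nfE kXE ltn_mod. Qed.

Let iS_x g k : iS (g * x ^+ k)%g = iS g.
Proof. by rewrite {1}[g]nfE -mulgA -expgD iSE modn_small. Qed.

Let kX_x g : kX (g * x)%g = if (kX g).+1 == m then 0%N else (kX g).+1.
Proof.
rewrite {1}[g]nfE -mulgA -expgSr kXE; case: eqP => [->|/eqP ne]; first exact: modnn.
by rewrite modn_small // ltn_neqAle ne kX_lt.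
Qed.

Let x_sk k : (x ^+ k * s = s * x ^+ (u * k))%g.
Proof.
elim: k => [|k IHk]; first by rewrite muln0 mul1g mulg1.
by rewrite expgS -mulgA IHk mulgA xs -mulgA -expgD mulnS.
Qed.

Let iS_s g : iS (g * s)%g = if (iS g).+1 == n then 0%N else (iS g).+1.
Proof.
rewrite {1}[g]nfE -mulgA x_sk mulgA -expgSr iSE; case: eqP => [->|/eqP ne]; first exact: modnn.
by rewrite modn_small // ltn_neqAle ne iS_lt.
Qed.

Let gr_nf g : gr g = S ^+ iS g * X ^+ kX g.
Proof. by rewrite {1}[g]nfE grM !grX. Qed.

Let geomX k : (\sum_(l < k) X ^+ l) * T = X ^+ k - 1.
Proof.
rewrite subrX1 mulrBr mulrBl mulr1 mul1r; congr (_ - _).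
by apply/commr_sym/commr_sum => l _; apply: commrX.
Qed.

Let geomS k : (\sum_(l < k) S ^+ l) * (S - 1) = S ^+ k - 1.
Proof.
rewrite subrX1 mulrBr mulrBl mulr1 mul1r; congr (_ - _).
by apply/commr_sym/commr_sum => l _; apply: commrX.
Qed.

(* The contracting homotopies of the periodic resolutions of <x> and of <s>,
   extended to G through the normal form g = s^i x^k. *)
Let K : R -> R := gring_lin (fun g => S ^+ iS g * \sum_(l < kX g) X ^+ l).
Let pi : R -> R := gring_lin (fun g => S ^+ iS g).
Let L : R -> R := gring_lin (fun g => S ^+ iS g *+ (kX g == m.-1)).
Let K' : R -> R := gring_lin (fun g => \sum_(l < iS g) S ^+ l).
Let L' : R -> int := gring_lin (fun g => (iS g == n.-1)%:R).

Let K_T b : K b * T = b - pi b.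
Proof.
apply: (@gring_ind _ _ (T \o* gring_lin _) (idfun \- gring_lin _)) => g /=.
by rewrite !gring_lin_gr -mulrA geomX mulrBr mulr1 gr_nf.
Qed.

Let K_mulT b : K (b * T) = b - L b * N.
Proof.
apply: (@gring_ind _ _ (gring_lin _ \o (T \o* idfun)) (idfun \- (N \o* gring_lin _))) => g /=.
rewrite mulrBr mulr1 -grM raddfB /= !gring_lin_gr -{1}[x]expg1 iS_x kX_x.
have [Ek|nk] := eqVneq (kX g).+1 m.
  have Ek' : kX g = m.-1 by rewrite -Ek.
  rewrite big_ord0 mulr0 sub0r Ek' eqxx mulr1n gr_nf Ek'.
  rewrite -mulrBr -mulrN; congr (_ * _).
  by rewrite /wall_N -(prednK m_gt0) big_ord_recr /= opprD addrCA subrr addr0.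
have -> : (kX g == m.-1) = false by lia.
by rewrite mulr0n mul0r subr0 big_ord_recr /= mulrDr addrC addKr gr_nf.
Qed.

Let L_mulN b : L (b * N) = pi b.
Proof.
apply: (@gring_ind _ _ (gring_lin _ \o (N \o* idfun)) (gring_lin _)) => g /=.
rewrite !gring_lin_gr gr_nf -mulrA wall_XN /wall_N mulr_sumr raddf_sum /=.
have m1 : (m.-1 < m)%N by rewrite prednK.
rewrite (bigD1 (Ordinal m1)) //= big1 => [|k nk].
  rewrite -!grX -grM gring_lin_gr iSE kXE !modn_small // eqxx mulr1n addr0.
  by rewrite grX.
rewrite -!grX -grM gring_lin_gr kXE modn_small //.
by case: eqP => [e|]; rewrite ?mulr0n //; case/eqP: nk; apply: val_inj.
Qed.

Let K'_S b : K' b * (S - 1) = pi b - (gring_aug b)%:~R.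
Proof.
pose e : {additive R -> R} := (intmul 1 \o @gring_aug G)%FUN.
apply: (@gring_ind _ _ ((S - 1) \o* gring_lin _) (gring_lin _ \- e)) => g /=.
by rewrite !gring_lin_gr geomS gring_aug_gr.
Qed.

Let K'_mulS b : K' (b * (S - 1)) = pi b - (L' b)%:~R * \sum_(l < n) S ^+ l.
Proof.
pose e : {additive R -> R} := (intmul 1 \o gring_lin (fun g => (iS g == n.-1)%:R : int))%FUN.
apply: (@gring_ind _ _ (gring_lin _ \o ((S - 1) \o* idfun))
  (gring_lin _ \- ((\sum_(l < n) S ^+ l) \o* e))) => g /=.
rewrite mulrBr mulr1 -grM raddfB /= !gring_lin_gr iS_s.
have [Ei|ni] := eqVneq (iS g).+1 n.
  have Ei' : iS g = n.-1 by rewrite -Ei.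
  rewrite big_ord0 sub0r Ei' eqxx mul1r.
  by rewrite -(prednK n_gt0) big_ord_recr /= opprD addrCA subrr addr0.
have -> : (iS g == n.-1) = false by lia.
by rewrite big_ord_recr /= [LHS]addrC addKr mul0r subr0.
Qed.

Let L'_mulnu b : L' (b * \sum_(l < n) S ^+ l) = gring_aug b.
Proof.
apply: (@gring_ind _ _ (gring_lin _ \o ((\sum_(l < n) S ^+ l) \o* idfun)) (@gring_aug G)) => g /=.
rewrite gring_aug_gr mulr_sumr raddf_sum /=.
under eq_bigr => l _ do rewrite -grX -grM gring_lin_gr.
transitivity (\sum_(l < n) (((iS g + l) %% n)%N == n.-1)%:R : int).
  apply: eq_bigr => l _; congr (_ == _)%:R; elim: (l : nat) => [|k IHk].
    by rewrite mulg1 addn0 modn_small.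
  rewrite expgSr mulgA iS_s IHk addnS.
  rewrite -[(iS g + k).+1]addn1 -(modnDml (_ + k) 1) addn1.
  have lt : ((iS g + k) %% n < n)%N by rewrite ltn_mod.
  move: lt; move: ((iS g + k) %% n)%N => k' lt.
  by case: eqP => [->|ne]; rewrite ?modnn // modn_small //; lia.
have lti := iS_lt g.
have ltl : (n.-1 - iS g < n)%N by lia.
rewrite (bigD1 (Ordinal ltl)) //= big1 => [|l nl].
  by rewrite subnKC ?modn_small ?eqxx ?addr0 //; lia.
case: eqP => // e; case/eqP: nl; apply: val_inj => /=.
have := ltn_ord l => ltln.
case: (ltnP (iS g + l) n) => [lt|le]; first by move: e; rewrite modn_small //; lia.
by move: e; rewrite -(subnK le) modnDr modn_small; lia.
Qed.

Let K'_mulT b : K' (b * T) = 0.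
Proof.
apply: (@gring_ind _ _ (gring_lin _ \o (T \o* idfun)) \0) => g /=.
by rewrite mulrBr mulr1 -grM raddfB /= !gring_lin_gr -[x]expg1 iS_x subrr.
Qed.

Let L'_mulT b : L' (b * T) = 0.
Proof.
apply: (@gring_ind _ _ (gring_lin _ \o (T \o* idfun)) \0) => g /=.
by rewrite mulrBr mulr1 -grM raddfB /= !gring_lin_gr -[x]expg1 iS_x subrr.
Qed.

Lemma wall_exact_T b : b * T = 0 -> exists e, b = e * N.
Proof.
move=> b0; exists (L b); apply/eqP; rewrite -subr_eq0 -K_mulT b0.
by rewrite [K 0]raddf0.
Qed.

Lemma wall_exact_N b : b * N = 0 -> exists e, b = e * T.
Proof.
move=> b0; exists (K b); rewrite K_T -L_mulN b0.
by rewrite [L 0]raddf0 subr0.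
Qed.

Lemma wall_exact_aug b :
  gring_aug b = 0 -> exists e1 e2, b = e1 * delta true 0 + e2 * T.
Proof.
move=> b0; exists (K' b), (K b); rewrite /wall_delta /wall_theta mulr1.
by rewrite K'_S K_T b0 subr0 addrC subrK.
Qed.

(** Modulo the left ideal generated by T the group ring becomes that of the quotient by x, cyclic of
    order n, where the periodic complex is exact. [K'] and [L'] kill this ideal, and [K] supplies
    the multiple of T. *)
Lemma wall_exact_delta odd_s b y : b * delta odd_s 0 + y * T = 0 ->
  exists e1 e2, b = e1 * delta (~~ odd_s) 0 + e2 * T.
Proof.
have K'N d : K' (- d) = - K' d by exact: raddfN.
have L'N d : L' (- d) = - L' d by exact: raddfN.
have dE : delta false 0 = \sum_(l < n) S ^+ l.
  by apply: eq_bigr => l _; rewrite /wall_theta mulr1.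
have dE' : delta true 0 = S - 1 by rewrite /wall_delta /wall_theta mulr1.
case: odd_s; rewrite [~~ _]/= dE dE' => /eqP; rewrite addr_eq0 => /eqP bE.
  exists (L' b)%:~R, (K b); rewrite K_T.
  have := K'_mulS b; rewrite bE K'N K'_mulT oppr0 => /esym/eqP.
  by rewrite subr_eq0 => /eqP <-; rewrite addrC subrK.
exists (K' b), (K b); rewrite K_T K'_S -L'_mulnu bE L'N L'_mulT oppr0.
by rewrite addr0 addrC subrK.
Qed.


(** The source generator has total degree q + 1 and fibre degree i, so q + 1 + i has the parity of
    its base degree. [uphalf i] is j for both rows 2j-1 and 2j. *)
Definition wall_D0 q i : R := (-1) ^+ (q.+1 + i) * (if odd i then T else N).
Definition wall_D1 q i : R := delta (odd (q.+1 + i)) (uphalf i).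
Definition wall_D2 q i : R := if odd i then (-1) ^+ (q + i) * (a (uphalf i))%:R else 0.
Local Notation D0 := wall_D0.
Local Notation D1 := wall_D1.
Local Notation D2 := wall_D2.

(* The generator of bidegree (s, t) of the total complex has index t in degree
   q = s + t, and D0, D1, D2 are the components of the differential of
   bidegrees (0, -1), (-1, 0) and (-2, 1). *)
Definition wall_mx q : 'M[R]_(q.+2, q.+1) := tridiag (D0 q) (D1 q) (D2 q) q.+2 q.+1.

Let opp_sign q (b : R) : (-1) ^+ q.+1 * b + (-1) ^+ q * b = 0.
Proof. by rewrite exprS mulN1r mulNr addNr. Qed.

Let sign_mulr k (b d : R) : b * ((-1) ^+ k * d) = (-1) ^+ k * (b * d).
Proof. by rewrite mulrA (commr_sign b k) mulrA. Qed.

Let opp_sign_mul k l (b d : R) : odd (k + l) ->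
  (-1) ^+ k * b * ((-1) ^+ l * d) = - (b * d).
Proof.
move=> odd_kl; rewrite sign_mulr !mulrA -exprD -mulrA -signr_odd addnC odd_kl.
by rewrite expr1 mulN1r.
Qed.

Let sign_sq k (b d : R) : (-1) ^+ k * b * ((-1) ^+ k * d) = b * d.
Proof. by rewrite sign_mulr !mulrA -expr2 sqrr_sign mul1r. Qed.

Let D0D0 q i : D0 q.+1 i.+1 * D0 q i = 0.
Proof.
rewrite /wall_D0 -mulrA sign_mulr oddS.
by case: (odd i); rewrite /= ?wall_NT ?wall_TN !mulr0.
Qed.

Let D1D0 q i : D1 q.+1 i.+1 * D0 q i.+1 + D0 q.+1 i.+1 * D1 q i = 0.
Proof.
have -> : D1 q.+1 i.+1 * D0 q i.+1 =
    (-1) ^+ (q.+1 + i.+1) * (D1 q.+1 i.+1 * if odd i.+1 then T else N).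
  by rewrite /wall_D0 sign_mulr.
have -> : D0 q.+1 i.+1 * D1 q i =
    (-1) ^+ (q.+1 + i.+1).+1 * (D1 q.+1 i.+1 * if odd i.+1 then T else N).
  rewrite /wall_D0 -mulrA addSn; congr (_ * _); rewrite /wall_D1.
  have -> : odd (q.+2 + i.+1) = odd (q.+1 + i) by rewrite addSn addnS /= negbK.
  rewrite [uphalf i.+1]/= uphalf_half oddS.
  by case: (odd i); rewrite ?wall_Ndelta ?wall_Tdelta.
by rewrite addrC opp_sign.
Qed.

Let D1D1 q i : D1 q.+1 i * D1 q i = N *+ a (uphalf i).
Proof.
rewrite /wall_D1 -(wall_delta_delta (odd (q.+2 + i))); congr (_ * delta _ _).
by rewrite [(q.+2 + i)%N]addSn oddS negbK.
Qed.

(** The square of D1 is a_j N. From an odd row it is cancelled by climbing with a_j and descending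
    with N, from an even row by the same maps in the other order; in row 0 it is zero. *)
Let D2D0 q i : D2 q.+1 i * D0 q i.+1 + D1 q.+1 i * D1 q i
  + (if i is i'.+1 then D0 q.+1 i * D2 q i' else 0) = 0.
Proof.
rewrite D1D1; case: i => [|i].
  by rewrite /wall_D2 /wall_a big_ord0 mul0n mulr0n mul0r !addr0.
rewrite /wall_D0 /wall_D2; case: (boolP (odd i)) => odd_i; rewrite oddS odd_i /=.
  rewrite mul0r add0r opp_sign_mul; last lia.
  by rewrite mulr_natr uphalf_half odd_i subrr.
rewrite mulr0 addr0 opp_sign_mul; last lia.
by rewrite mulr_natl (negPf odd_i) addNr.
Qed.

Let D2D1 q i : D2 q.+1 i * D1 q i.+1 + D1 q.+1 i * D2 q i = 0.
Proof.
rewrite /wall_D1 /wall_D2; case: (boolP (odd i)) => odd_i; last by rewrite mul0r mulr0 addr0.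
have -> : odd (q.+1 + i.+1) = odd (q.+2 + i) by rewrite addnS.
have -> : uphalf i.+1 = uphalf i by rewrite /= uphalf_half odd_i.
rewrite sign_mulr -mulrA addSn mulr_natl mulr_natr exprS mulN1r mulNr.
by rewrite addNr.
Qed.

Let D2D2 q i : D2 q.+1 i * D2 q i.+1 = 0.
Proof. by rewrite /wall_D2 oddS; case: odd; rewrite ?mul0r ?mulr0. Qed.

Let wall_dif_dif_entry q i k
    (f := fun j => D0 q.+1 i *+ (i == j.+1) + D1 q.+1 i *+ (i == j) + D2 q.+1 i *+ (i.+1 == j)) :
  f k.+1 * D0 q k.+1 + f k * D1 q k + (if k is k'.+1 then f k' * D2 q k' else 0) = 0.
Proof.
have f0 j : i <> j.+1 -> i <> j -> i.+1 <> j -> f j = 0.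
  by move=> /eqP/negPf e1 /eqP/negPf e2 /eqP/negPf e3; rewrite /f e1 e2 e3 !addr0.
have fE0 j : i = j.+1 -> f j = D0 q.+1 i.
  move=> e; have /negPf e1 : i != j by rewrite e neq_ltn ltnSn orbT.
  have /negPf e2 : i.+1 != j by rewrite e neq_ltn leqnSn orbT.
  by rewrite /f e1 e2 e eqxx !addr0.
have fE1 j : i = j -> f j = D1 q.+1 i.
  move=> e; have /negPf e1 : i != j.+1 by rewrite e neq_ltn ltnSn.
  have /negPf e2 : i.+1 != j by rewrite e neq_ltn ltnSn orbT.
  by rewrite /f e1 e2 e eqxx add0r addr0.
have fE2 j : i.+1 = j -> f j = D2 q.+1 i.
  move=> e; have /negPf e1 : i != j.+1 by rewrite -e neq_ltn leqnSn.
  have /negPf e2 : i != j by rewrite -e neq_ltn ltnSn.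
  by rewrite /f e1 e2 e eqxx !add0r.
(* The cases i - k = 2, 1, 0, -1, -2 are the components of the squared differential; outside them
   every term is zero. *)
have [e|ne2] := eqVneq i k.+2.
  rewrite fE0 // f0 ?e; try lia; rewrite mul0r addr0 D0D0 add0r.
  by case: k e => // k e; rewrite f0 ?mul0r //; lia.
have [e|ne1] := eqVneq i k.+1.
  rewrite fE1 // fE0 // e D1D0 add0r.
  by case: k e {ne2} => // k e; rewrite f0 ?mul0r //; lia.
have [e|ne0] := eqVneq i k.
  rewrite fE2 ?e // fE1 // -[RHS](D2D0 q k) e; congr (_ + _).
  by case: k e {ne2 ne1} => // k e; rewrite fE0 // e.
have [e|nem1] := eqVneq i.+1 k.
  by rewrite -e (f0 i.+2) ?(fE2 i.+1) ?(fE1 i) ?mul0r ?add0r ?D2D1 //; lia.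
case: k ne2 ne1 ne0 nem1 => [|k] ne2 ne1 ne0 nem1.
  by rewrite !f0 ?mul0r ?addr0 //; lia.
have [e|nem2] := eqVneq i.+1 k.
  by rewrite -e (f0 i.+2) ?(f0 i.+3) ?(fE2 i.+1) ?mul0r ?add0r ?D2D2 //; lia.
by rewrite !f0 ?mul0r ?addr0 //; lia.
Qed.

Lemma wall_dif_dif q : wall_mx q.+1 *m wall_mx q = 0.
Proof.
apply/row_matrixP=> i; rewrite row_mul row0 [row i _]row_inord; apply/rowP=> k.
have := row_mul_tridiag (D0 q) (D1 q) (D2 q)
  (fun j => D0 q.+1 i *+ (nat_of_ord i == j.+1) + D1 q.+1 i *+ (nat_of_ord i == j) + D2 q.+1 i *+ (i.+1 == j)) k.
rewrite wall_dif_dif_entry => fE; rewrite [RHS]mxE -fE; congr ((_ *m _) 0 k); apply/rowP=> j.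
by rewrite !mxE inord_val.
Qed.

Let wall_rowE q (v : 'rV[R]_q.+2) (j : 'I_q.+1) : (v *m wall_mx q) 0 j =
  v 0 (inord j.+1) * D0 q j.+1 + v 0 (inord j) * D1 q j
  + (if nat_of_ord j is j'.+1 then v 0 (inord j') * D2 q j' else 0).
Proof.
by rewrite [v in LHS]row_inord (row_mul_tridiag _ _ _ (fun j => v 0 (inord j))).
Qed.

Let wall_exact_D0 q i (b : R) : b * D0 q i = 0 -> exists e, b = e * D0 q.+1 i.+1.
Proof.
rewrite /wall_D0 oddS sign_mulr => b0.
have {}b0 : b * (if odd i then T else N) = 0.
  by move/(congr1 (GRing.mul ((-1) ^+ (q.+1 + i)))): b0; rewrite mulrA -expr2 sqrr_sign mul1r mulr0.
have [e bE] : exists e, b = e * (if ~~ odd i then T else N).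
  by case: (odd i) b0; [exact: wall_exact_T | exact: wall_exact_N].
exists (e * (-1) ^+ (q.+2 + i.+1)).
by rewrite -mulrA (mulrA ((-1) ^+ _)) -expr2 sqrr_sign mul1r.
Qed.

(** Entries are killed by increasing fibre degree. Entry 0 uses exactness of the base complex modulo
    T. Once entries up to t vanish, column t of the cycle equation says that D0 kills entry t+1,
    which exactness of the fibre resolution then removes. *)
Lemma wall_mx_exact q (v : 'rV[R]_q.+2) :
  v *m wall_mx q = 0 -> exists w, v = w *m wall_mx q.+1.
Proof.
move=> v0.
suff [w wE] : exists w, forall j : 'I_q.+2, (j < q.+2)%N -> (v - w *m wall_mx q.+1) 0 j = 0.
  by exists w; apply/eqP; rewrite -subr_eq0; apply/eqP/rowP=> j; rewrite [RHS]mxE wE.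
suff P t : (t < q.+2)%N ->
    exists w, forall j : 'I_q.+2, (j <= t)%N -> (v - w *m wall_mx q.+1) 0 j = 0.
  by have [w wE] := P q.+1 (ltnSn _); exists w => j _; apply: wE; rewrite -ltnS.
elim: t => [_|t IHt ltt].
  have := wall_rowE v ord0; rewrite v0 mxE /= addr0 addrC /wall_D0 /wall_D1 addn1 addn0.
  rewrite sign_mulr mulrA => /esym/wall_exact_delta[e1 [e2 eE]].
  (* The sign in front of e2 cancels that of [wall_D0 q.+1 1]. *)
  pose f j := if j is j'.+1 then if j' is 0 then (-1) ^+ q.+3 * e2 else 0 else e1.
  exists (\row_(j < q.+3) f j) => j; rewrite leqn0 => /eqP j0.
  rewrite mxE [X in _ + X]mxE row_mul_tridiag j0 /= addr0 /wall_D0 /wall_D1 addn1 addn0.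
  rewrite sign_sq; apply/eqP; rewrite subr_eq0 addrC.
  have -> : j = inord 0 by apply: val_inj; rewrite /= j0 inordK.
  by rewrite eE /= negbK.
have [w wE] := IHt (ltnW ltt).
pose v' := v - w *m wall_mx q.+1.
have v'0 : v' *m wall_mx q = 0 by rewrite mulmxBl v0 -mulmxA wall_dif_dif mulmx0 subrr.
have ltt' : (t < q.+1)%N by [].
have v'le k : (k <= t)%N -> v' 0 (inord k) = 0.
  by move=> lekt; rewrite wE // inordK //; lia.
have := wall_rowE v' (Ordinal ltt'); rewrite v'0 mxE /= (v'le t) // mul0r addr0.
have -> : (match t with 0 => 0 | k.+1 => v' 0 (inord k) * D2 q k end) = 0 :> R.
  by case: t v'le {IHt ltt wE ltt'} => // t v'le; rewrite v'le ?mul0r.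
rewrite addr0 => /esym/wall_exact_D0[e eE].
(* The correction sits at index t+2: D0 brings it to t+1, while D1 and D2 reach only higher indices,
   so entries already killed stay zero. *)
exists (w + e *: delta_mx 0 (inord t.+2)) => j lejt.
rewrite mulmxDl opprD addrA -/v' -scalemxAl -rowE; clearbody v'; rewrite !mxE.
rewrite inordK; last exact: ltt.
move: lejt; rewrite leq_eqVlt => /orP[/eqP jE|ltj].
  have -> : j = inord t.+1 by apply: val_inj; rewrite /= inordK.
  rewrite eE inordK // eqxx.
  have -> : (t.+2 == t.+1) = false by lia.
  have -> : (t.+3 == t.+1) = false by lia.
  by rewrite !addr0 subrr.
have -> : (t.+2 == j.+1) = false by lia.
have -> : (t.+2 == j) = false by lia.
have -> : (t.+3 == j) = false by lia.
by rewrite !addr0 mulr0 subr0 -[j]inord_val v'le.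
Qed.

Lemma wall_row_aug_dif (v : 'rV[R]_2) : row_aug (@gring_aug G) (v *m wall_mx 0) = 0.
Proof.
rewrite /row_aug big_ord1 (wall_rowE v ord0) addr0.
have D0E : gring_aug (D0 0 1) = 0.
  by rewrite rmorphM raddfB /= gring_aug_gr rmorph1 subrr mulr0.
have D1E : gring_aug (D1 0 0) = 0.
  have -> : D1 0 0 = gr s - 1 by rewrite /wall_D1 /wall_delta /wall_theta /= mulr1.
  by rewrite raddfB /= gring_aug_gr rmorph1 subrr.
rewrite -[LHS]/(gring_aug (v 0 (inord 1) * D0 0 1 + v 0 (inord 0) * D1 0 0)).
by rewrite gring_augD (gring_augM _ (D0 0 1)) (gring_augM _ (D1 0 0)) D0E D1E !mulr0 addr0.
Qed.

Lemma wall_row_aug_exact (v : 'rV[R]_1) :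
  row_aug (@gring_aug G) v = 0 -> exists w, v = w *m wall_mx 0.
Proof.
rewrite /row_aug big_ord1 => /wall_exact_aug[e1 [e2 vE]].
exists (\row_(j < 2) (if j == 0 :> nat then e1 else e2)); apply/rowP=> j.
rewrite ord1 vE (row_mul_tridiag _ _ _ (fun j => if j == 0%N then e1 else e2)) /=.
by rewrite addr0 /wall_D0 addn1 -signr_odd mul1r addrC.
Qed.

Definition wall_resolution : resolution (@gring_aug G) :=
  @Resolution _ _ succn wall_mx erefl wall_dif_dif wall_mx_exact
    wall_row_aug_dif wall_row_aug_exact.

(** Under the augmentation T becomes 0, N becomes m and theta_j becomes u^j. *)
Lemma wall_coinv_dif q : coinv_dif wall_resolution q =
  tridiag (fun i => (-1) ^+ (q.+1 + i) * (if odd i then 0 else m%:R))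
    (fun i => if odd (q.+1 + i) then (u%:R ^+ uphalf i) - 1
              else \sum_(l < n) (u%:R ^+ uphalf i) ^+ l)
    (fun i => if odd i then (-1) ^+ (q + i) * (a (uphalf i))%:R else 0) q.+2 q.+1.
Proof.
rewrite /coinv_dif map_tridiag; apply/matrixP=> i j; rewrite !mxE.
have aug_sum k (F : 'I_k -> R) : gring_aug (\sum_i F i) = \sum_i gring_aug (F i).
  exact: raddf_sum.
have aug_sumX k : gring_aug (\sum_(l < k) gr x ^+ l) = k%:R.
  rewrite aug_sum -[k in RHS]card_ord -sumr_const; apply: eq_bigr => l _.
  by rewrite gring_augX gring_aug_gr expr1n.
have aug_sub1 (b : R) : gring_aug (b - 1) = gring_aug b - 1.
  by rewrite -(rmorph1 (@gring_aug G)); exact: raddfB.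
have augth k : gring_aug (theta k) = u%:R ^+ k.
  by rewrite gring_augM gring_aug_gr mul1r gring_augX aug_sumX.
have aug_sign k (b : R) : gring_aug ((-1) ^+ k * b) = (-1) ^+ k * gring_aug b.
  by rewrite rmorphM rmorphXn rmorphN1.
congr (_ *+ _ + _ *+ _ + _ *+ _).
- rewrite -[LHS]/(gring_aug (D0 q i)) /wall_D0 aug_sign; congr (_ * _).
  case: odd; last exact: aug_sumX.
  by rewrite aug_sub1 gring_aug_gr subrr.
- rewrite -[LHS]/(gring_aug (D1 q i)) /wall_D1 /wall_delta; case: odd; first by rewrite aug_sub1 augth.
  by rewrite aug_sum; apply: eq_bigr => k _; rewrite gring_augX augth.
- rewrite -[LHS]/(gring_aug (D2 q i)) /wall_D2; case: odd; last by rewrite raddf0.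
  by rewrite aug_sign; congr (_ * _); exact: rmorph_nat.
Qed.

End Wall.

(** * Homology of the complex of coinvariants *)

Section SplitComplex.
Local Open Scope ring_scope.
Import Num.Theory.
Variables (m n : nat) (a : nat -> nat) (D : bool -> nat -> int).
Hypotheses (m_gt0 : (0 < m)%N) (n_gt0 : (0 < n)%N).
Hypotheses (Dt0 : D true 0 = 0) (Df0 : D false 0 = n%:R).
Hypothesis DD : forall b j, D b j * D (~~ b) j = m%:R * (a j)%:R.

Definition split_mx q : 'M[int]_(q.+2, q.+1) :=
  tridiag (fun i => (-1) ^+ (q.+1 + i) * (if odd i then 0 else m%:R))
    (fun i => D (odd (q.+1 + i)) (uphalf i))
    (fun i => if odd i then (-1) ^+ (q + i) * (a (uphalf i))%:R else 0) q.+2 q.+1.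

Hypothesis split_mx_mul : forall q, split_mx q.+1 *m split_mx q = 0.

(** At index 2j-1 cycles take the multiples of [b j] as values, boundaries those of [b j * o j], so
    [o j] is the order of the j-th summand. The guard in [bP] is there because row 2j may lie above
    degree q + 1; then the entry is unconstrained. *)
Variables (q : nat) (b o : nat -> nat).
Hypothesis b_gt0 : forall j, (0 < b j)%N.
Hypothesis bP : forall j z, (0 < j)%N ->
  ((b j)%:Z %| z)%Z <-> ((j.*2 <= q.+1)%N -> (m%:Z %| z * D (odd q) j)%Z).
Hypothesis boP : forall j z, (0 < j)%N ->
  ((b j * o j)%N%:Z %| z)%Z <-> exists x y, z = x * D (~~ odd q) j + y * m%:R.

(** A cycle is determined by entry 0 and its odd entries, since m times an even entry is fixed by
    the odd one before it. *)
Definition split_coord j (v : 'rV[int]_(q.+2)) : int :=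
  if j is j'.+1 then divz (v 0 (inord (j'.*2.+1))) (b j) else v 0 0.

Let rowE k (v : 'rV[int]_k.+2) (j : 'I_k.+1) : (v *m split_mx k) 0 j =
  v 0 (inord j.+1) * ((-1) ^+ (k + j) * (if odd j then m%:R else 0))
  + v 0 (inord j) * D (odd (k.+1 + j)) (uphalf j)
  + (if nat_of_ord j is i.+1
     then v 0 (inord i) * (if odd i then (-1) ^+ (k + i) * (a (uphalf i))%:R else 0) else 0).
Proof.
rewrite [v in LHS]row_inord (row_mul_tridiag _ _ _ (fun j => v 0 (inord j))).
congr (_ * _ + _ + _); rewrite oddS addSn addnS 2!exprS !mulN1r opprK.
by case: odd.
Qed.

Let row_odd k (v : 'rV[int]_k.+2) j : (j.*2.+1 < k.+1)%N ->
  (v *m split_mx k) 0 (inord j.*2.+1) =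
  (-1) ^+ k.+1 * m%:R * v 0 (inord j.*2.+2) + v 0 (inord j.*2.+1) * D (odd k) j.+1.
Proof.
move=> ltj; rewrite rowE inordK //= odd_double /= mulr0 addr0.
have -> : odd (k + j.*2.+1) = ~~ odd k by rewrite addnS /= oddD odd_double addbF.
rewrite negbK doubleK; congr (_ + _); rewrite mulrC; congr (_ * _ * _).
by rewrite addnS -addSn exprD -[(-1) ^+ j.*2]signr_odd odd_double mulr1.
Qed.

Let row_even k (v : 'rV[int]_k.+2) j : (j.*2.+2 < k.+1)%N ->
  (v *m split_mx k) 0 (inord j.*2.+2) =
  v 0 (inord j.*2.+2) * D (~~ odd k) j.+1
  + (-1) ^+ k.+1 * (a j.+1)%:R * v 0 (inord j.*2.+1).
Proof.
move=> ltj; rewrite rowE inordK //= odd_double /= !mulr0 add0r.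
have -> : odd (k + j.*2.+2) = odd k by rewrite !addnS /= negbK oddD odd_double addbF.
rewrite uphalf_double doubleK [in X in _ + X]mulrC; congr (_ * D _ _ + _ * _ * _).
by rewrite addnS -addSn exprD -[(-1) ^+ j.*2]signr_odd odd_double mulr1.
Qed.

Let row_zero k (v : 'rV[int]_k.+2) :
  (v *m split_mx k) 0 0 = v 0 0 * D (~~ odd k) 0.
Proof.
rewrite rowE /= addr0 mulr0 mulr0 add0r addn0; congr (v 0 _ * _).
by apply: val_inj; rewrite /= inordK.
Qed.

Let m0 : (m%:R : int) != 0. Proof. by rewrite pnatr_eq0 -lt0n. Qed.
Let n0 : (n%:R : int) != 0. Proof. by rewrite pnatr_eq0 -lt0n. Qed.

(** The equations at positive even columns follow from those at odd columns: multiply by m,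
    substitute, and use [DD]. *)
Lemma split_cycleP (v : 'rV[int]_(q.+2)) :
  v *m split_mx q = 0 <->
  [/\ v 0 0 * D (~~ odd q) 0 = 0 &
  forall j, (j.*2.+2 <= q.+1)%N ->
  (-1) ^+ q.+1 * m%:R * v 0 (inord j.*2.+2) + v 0 (inord j.*2.+1) * D (odd q) j.+1 = 0].
Proof.
split=> [v0|[v0 vB]].
  split=> [|j ltj]; first by rewrite -row_zero v0 mxE.
  by rewrite -row_odd ?v0 ?mxE.
apply/rowP=> i; rewrite [RHS]mxE -[i]inord_val; case: i => i lti /=.
have [odd_i|even_i] := boolP (odd i).
  have : i = (i./2).*2.+1 by rewrite -{1}[i]odd_double_half odd_i.
  by move: (i./2) => j iE; rewrite iE in lti *; rewrite row_odd ?vB.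
have : i = (i./2).*2 by rewrite -{1}[i]odd_double_half (negPf even_i).
case: (i./2) => [|j] iE.
  by rewrite iE (_ : inord 0 = 0) ?row_zero //; apply: val_inj; rewrite /= inordK.
rewrite iE doubleS in lti *; rewrite row_even //.
apply: (mulfI m0); rewrite mulr0.
have := vB j; rewrite ltnW // => /(_ isT) => e.
have {}e : m%:R * v 0 (inord j.*2.+2) = (-1) ^+ q * (v 0 (inord j.*2.+1) * D (odd q) j.+1).
  move/eqP: e; rewrite addr_eq0 => /eqP/(congr1 (GRing.mul ((-1) ^+ q.+1))).
  by rewrite !mulrA -expr2 sqrr_sign mul1r => ->; rewrite exprS; ring.
rewrite mulrDr mulrA e -!mulrA DD exprS; ring.
Qed.


Let cycle_dvd (v : 'rV[int]_(q.+2)) j : v *m split_mx q = 0 -> (b j.+1 %| v 0%R (inord j.*2.+1))%Z.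
Proof.
move=> /split_cycleP[_ vB]; apply/bP => // ltj; rewrite doubleS in ltj.
have /eqP := vB j ltj; rewrite addrC addr_eq0 => /eqP ->.
by rewrite natz rpredN /= mulrAC dvdz_mull.
Qed.

Lemma split_coordB (v w : 'rV[int]_(q.+2)) j :
  v *m split_mx q = 0 -> w *m split_mx q = 0 ->
  split_coord j (v - w) = split_coord j v - split_coord j w.
Proof.
case: j => [|j] v0 w0; rewrite /split_coord !mxE //.
have [x ->] := dvdzP (cycle_dvd j v0); have [y ->] := dvdzP (cycle_dvd j w0).
by rewrite -mulrBl !mulzK // lt0r_neq0 // ltz_nat.
Qed.

(** The guard excludes coordinate 0 for even q + 1: there a cycle equation multiplies it by n, so it
    must be zero. *)
Lemma split_coord_surj (c : nat -> int) :
  exists2 v : 'rV[int]_(q.+2), v *m split_mx q = 0 &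
    forall j, (j <= uphalf q.+1)%N -> (j == 0%N) ==> odd q.+1 -> split_coord j v = c j.
Proof.
(* z is the entry wanted at 2j+1, and y the entry at 2j+2 that the cycle equation forces; [bP] makes
   the division exact. *)
pose z j := c j.+1 * b j.+1.
pose y j := (- (-1) ^+ q.+1 * z j * D (odd q) j.+1 %/ m)%Z.
pose f t := if t is 0 then (if odd q then 0 else c 0%N) else
  if odd t then z t./2 else y t./2.-1.
have fE t : (t < q.+2)%N -> (\row_(t < q.+2) f t) 0 (inord t) = f t.
  by move=> ltt; rewrite mxE inordK.
exists (\row_(t < q.+2) f t).
  apply/split_cycleP; split=> [|j ltj].
    by rewrite mxE /f /=; case: (odd q); rewrite ?mul0r // Dt0 mulr0.
  rewrite !fE //; last by rewrite ltnW.
  have -> : f j.*2.+1 = z j by rewrite /f /= odd_double /= uphalf_double.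
  have -> : f j.*2.+2 = y j by rewrite /f /= odd_double /= doubleK.
  have dz : (m %| z j * D (odd q) j.+1)%Z.
    by apply: (bP (z j) (ltn0Sn j)).1 => //; rewrite dvdz_mull.
  rewrite /y -mulrA natz [m%:Z * _]mulrC divzK; last by rewrite -mulrA dvdz_mull.
  rewrite !mulNr mulrN !mulrA -expr2 sqrr_sign mul1r addNr //.
case=> [|j] ltj; rewrite /split_coord.
  by rewrite mxE /f /=; case: (odd q).
move=> _; rewrite fE; last by lia.
by rewrite /f /= odd_double /= uphalf_double mulzK // lt0r_neq0 // ltz_nat.
Qed.

Lemma split_boundaryP (v : 'rV[int]_(q.+2)) : v *m split_mx q = 0 ->
  (exists w, v = w *m split_mx q.+1) <->
  (forall j, (0 < j <= uphalf q.+1)%N -> ((o j)%:Z %| split_coord j v)%Z) /\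
  (odd q.+1 -> (n%:Z %| split_coord 0 v)%Z).
Proof.
move=> v0; have dvd_coord j : ((b j.+1 * o j.+1)%N%:Z %| v 0%R (inord j.*2.+1))%Z =
    ((o j.+1)%:Z %| split_coord j.+1 v)%Z.
  rewrite /split_coord -[X in (_ %| X)%Z](@divzK (b j.+1)); last exact: cycle_dvd.
  by rewrite PoszM [(b _)%:Z * _]mulrC dvdz_mul2r // lt0r_neq0 // ltz_nat.
split=> [[w vE]|[vo vn]].
  split=> [[//|j] /= ltj|odd_q].
    rewrite -dvd_coord; apply/boP=> //; rewrite vE row_odd; last by lia.
    exists (w 0 (inord j.*2.+1)), ((-1) ^+ q.+2 * w 0 (inord j.*2.+2)).
    rewrite /= addrC; congr (_ + _); ring.
  by rewrite /split_coord vE row_zero /= in odd_q *; rewrite negbK (negPf odd_q) Df0 natz dvdz_mull.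
have /choice[x xE] j : exists x, (j.*2.+1 < q.+2)%N -> v 0 (inord j.*2.+1) =
    x.1 * D (~~ odd q) j.+1 + x.2 * m%:R.
  case: (ltnP j.*2.+1 q.+2) => ltj; last by exists (0, 0).
  have /boP[//|x [y xyE]] : ((b j.+1 * o j.+1)%N%:Z %| v 0%R (inord j.*2.+1))%Z.
    by rewrite dvd_coord vo //; lia.
  by exists (x, y).
pose f t := if t is 0 then (if odd q then 0 else (v 0%R 0%R %/ n)%Z) else
  if odd t then (x t./2).1 else (-1) ^+ q.+2 * (x t./2.-1).2.
have fE t : (t < q.+3)%N -> (\row_(t < q.+3) f t) 0 (inord t) = f t.
  by move=> ltt; rewrite mxE inordK.
have fo j : f j.*2.+1 = (x j).1 by rewrite /f /= odd_double /= uphalf_double.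
have fe j : f j.*2.+2 = (-1) ^+ q.+2 * (x j).2 by rewrite /f /= odd_double /= doubleK.
pose w := \row_(t < q.+3) f t; exists w.
(* The candidate w matches the odd entries and, for even q, entry 0. The difference d is a cycle,
   and its remaining entries vanish because m and n are nonzero. *)
pose d := v - w *m split_mx q.+1.
have d0 : d *m split_mx q = 0 by rewrite mulmxBl v0 -mulmxA split_mx_mul mulmx0 subrr.
apply/eqP; rewrite -subr_eq0 -/d; apply/eqP.
have d_odd j : (j.*2.+1 < q.+2)%N -> d 0 (inord j.*2.+1) = 0.
  move=> ltj; rewrite mxE [X in _ + X]mxE row_odd // !fE //; last by rewrite ltnW.
  by rewrite fo fe xE // mulrACA -expr2 sqrr_sign mul1r [m%:R * _]mulrC [X in _ - X]addrC subrr.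
have [dz dB] := (split_cycleP d).1 d0.
apply/rowP=> i; rewrite [RHS]mxE -[i]inord_val; case: i => i lti /=.
have [odd_i|even_i] := boolP (odd i).
  have : i = (i./2).*2.+1 by rewrite -{1}[i]odd_double_half odd_i.
  by move: (i./2) => j iE; rewrite iE in lti *; rewrite d_odd.
have : i = (i./2).*2 by rewrite -{1}[i]odd_double_half (negPf even_i).
case: (i./2) => [|j] iE; last first.
  rewrite iE doubleS in lti *; have := dB j lti.
  rewrite d_odd ?mul0r ?addr0; last by rewrite ltnW.
  move/eqP; rewrite mulf_eq0 => /orP[|/eqP //].
  by rewrite mulf_eq0 signr_eq0 (negPf m0).
rewrite iE (_ : inord _ = 0); last by apply: val_inj; rewrite /= inordK.
have := dz; case: (boolP (odd q)) => odd_q /=.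
  by rewrite Df0 => /eqP; rewrite mulf_eq0 (negPf n0) orbF => /eqP.
move=> _; rewrite mxE [X in _ + X]mxE row_zero /= negbK (negPf odd_q) Df0 mxE /f /= (negPf odd_q).
by rewrite natz divzK ?subrr //; apply: vn.
Qed.

End SplitComplex.

(** * Powers of a primitive root *)

Section PowerSums.
Variables (p r : nat).
Hypotheses (p_pr : prime p) (p_odd : odd p) (r_gt0 : 0 < r).

Let p_gt0 : 0 < p := prime_gt0 p_pr.
Let p_gt1 : 1 < p := prime_gt1 p_pr.

Lemma gcdn_pexp x e : e <= r -> (forall i, i <= r -> (p ^ i %| x) = (i <= e)) ->
  gcdn x (p ^ r) = p ^ e.
Proof.
move=> le_er xE; have /dvdn_pfactor : gcdn x (p ^ r) %| p ^ r by exact: dvdn_gcdr.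
move=> /(_ p_pr)[k le_kr gE].
have : p ^ k %| x by rewrite -gE dvdn_gcdl.
have : p ^ e %| gcdn x (p ^ r) by rewrite dvdn_gcd xE // leqnn dvdn_exp2l.
rewrite xE // gE dvdn_Pexp2l // => le_ek le_ke.
by congr (p ^ _); apply/eqP; rewrite eqn_leq le_ek le_ke.
Qed.

Lemma modn_pow_add1 t i : exists c, (1 + p * t) ^ i = 1 + i * (p * t) + p ^ 2 * c.
Proof.
elim: i => [|i [c IHi]]; first by exists 0; rewrite mul0n muln0.
by exists (c + i * t ^ 2 + c * p * t); rewrite expnS IHi; ring.
Qed.

(** For z = 1 + p t, expansion modulo p^2 gives p (1 + t C(p,2) + p c'); as p is odd it divides
    C(p,2), so the cofactor is 1 modulo p. *)
Lemma logn_sum_pow_p z : z = 1 %[mod p] -> logn p (\sum_(i < p) z ^ i) = 1.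
Proof.
move=> z1; have [t ->] : exists t, z = 1 + p * t.
  exists (z %/ p); have := divn_eq z p; rewrite z1 modn_small //; lia.
have /choice[c cE] := modn_pow_add1 t.
have -> : \sum_(i < p) (1 + p * t) ^ i =
    p * (1 + t * \sum_(i < p) i + p * \sum_(i < p) c i).
  under eq_bigr => i _ do rewrite cE.
  rewrite !big_split /= sum_nat_const card_ord muln1 -big_distrl -big_distrr /=; ring.
have -> : \sum_(i < p) i = 'C(p, 2) by rewrite -bin2_sum big_mkord.
have /dvdnP[k ->] : p %| 'C(p, 2).
  by rewrite prime_dvd_bin //=; move: p_gt1 p_odd; case: (p) => [|[|[|]]].
rewrite lognM ?p_gt0 -?addnA //.
rewrite logn_prime // eqxx; set c' := \sum_(i < p) _.
have -> : 1 + (t * (k * p) + p * c') = 1 + p * (t * k + c') by ring.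
rewrite lognE p_pr /=; case: ifP => //.
by rewrite dvdn_addl ?dvdn_mulr // dvdn1 => /eqP p1; move: p_gt1; rewrite p1.
Qed.

(** Each factor p of the length splits off a sum of p powers, of valuation 1; the remaining sum of d
    terms is d modulo p. *)
Lemma logn_sum_pow y d k : y = 1 %[mod p] -> ~~ (p %| d) ->
  logn p (\sum_(l < p ^ k * d) y ^ l) = k.
Proof.
move=> y1 ndp; have yX1 b : y ^ b = 1 %[mod p] by rewrite -modnXm y1 modnXm exp1n.
have d_gt0 : 0 < d by case: (d) ndp => //; rewrite dvdn0.
have sum_gt0 z b : 0 < b -> 0 < \sum_(l < b) z ^ l.
  by case: b => // b _; rewrite big_ord_recl expn0.
elim: k => [|k IHk].
  rewrite mul1n; apply/eqP; rewrite -leqn0 leqNgt logn_gt0 mem_primes negb_and.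
  rewrite p_pr sum_gt0 //=; suff -> : (p %| \sum_(l < d) y ^ l) = (p %| d) by [].
  rewrite /dvdn; congr (_ == _); rewrite -modn_summ.
  under eq_bigr => l _ do rewrite yX1.
  by rewrite modn_summ sum_nat_const card_ord muln1.
have := geometric_sumM y p (p ^ k * d).
rewrite mulnA -expnS => sE.
have -> : \sum_(l < p ^ k.+1 * d) y ^ l =
    (\sum_(l < p ^ k * d) y ^ l) * \sum_(i < p) (y ^ (p ^ k * d)) ^ i by exact: sE.
rewrite lognM ?sum_gt0 ?muln_gt0 ?expn_gt0 ?p_gt0 // IHk.
by rewrite logn_sum_pow_p ?addn1 // yX1.
Qed.

Variable u : nat.
Hypothesis u_gen : forall y, coprime y p -> exists k, u ^ k = y %[mod p ^ r].
Hypothesis u_coprime : coprime u p.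

(** A primitive root modulo p^r stays one modulo p^i, where its order is the totient of p^i. *)
Lemma expn_eq1_mod i j : 0 < i <= r -> (u ^ j == 1 %[mod p ^ i]) = (p ^ i.-1 * p.-1 %| j).
Proof.
case/andP=> i_gt0 le_ir.
have pi_gt1 : 1 < p ^ i by rewrite -(exp1n i) ltn_exp2r.
have uu : ((u%:R)%R : 'Z_(p ^ i)) \is a GRing.unit.
  by rewrite unitZpE // coprime_sym coprimeXr.
pose U : {unit 'Z_(p ^ i)} := FinRing.unit 'Z_(p ^ i) uu.
have UX k : val (U ^+ k)%g = (u ^ k)%:R%R by rewrite FinRing.val_unitX natrX.
have valE k l : ((k%:R : 'Z_(p ^ i)) == l%:R)%R = (k == l %[mod p ^ i]).
  by rewrite -val_eqE /= !val_Zp_nat.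
have genU : [set: {unit 'Z_(p ^ i)}] = <[U]>%g.
  apply/setP=> y; rewrite inE; apply/esym/cycleP.
  have : (val y : 'Z_(p ^ i)) \is a GRing.unit by exact: valP.
  rewrite -[val y]natr_Zp unitZpE // coprime_pexpl // coprime_sym => /u_gen[k kE].
  exists k; apply: val_inj; rewrite /= UX -[val y]natr_Zp; apply/eqP.
  rewrite valE; move/eqP: kE; rewrite eq_sym => /eqP kE.
  have dvdi : p ^ i %| p ^ r by rewrite dvdn_exp2l.
  by rewrite -(modn_dvdm (u ^ k) dvdi) -kE modn_dvdm.
have oU : #[U]%g = p ^ i.-1 * p.-1.
  by rewrite orderE -genU -[LHS]/(#|units_Zp (p ^ i)|) card_units_Zp ?totient_pfactor ?(ltnW pi_gt1) // mulnC.
by rewrite -oU order_dvdn -val_eqE /= UX -valE.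
Qed.

Definition vexp j : nat := if p.-1 %| j then minn (logn p j).+1 r else 0.
Definition nuexp j : nat := if p.-1 %| j then r.-1 else r.

Lemma dvdn_pexp_mul i j : 0 < j -> (p ^ i * p.-1 %| j) = (i <= logn p j) && (p.-1 %| j).
Proof.
move=> j_gt0; rewrite Gauss_dvd ?pfactor_dvdn //.
by rewrite coprimeXl // -{1}(prednK p_gt0) coprimeSn.
Qed.

Lemma gcdn_pow_sub1 j : 0 < j -> gcdn (u ^ j - 1) (p ^ r) = p ^ vexp j.
Proof.
move=> j_gt0; have u_gt0 : 0 < u.
  by case: (u) u_coprime => //; rewrite /coprime gcd0n; case: (p) p_gt1 => [|[]].
apply: gcdn_pexp => [|i le_ir]; first by rewrite /vexp; case: ifP => // _; exact: geq_minr.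
case: i le_ir => [|i] lt_ir; first by rewrite dvd1n.
rewrite -eqn_mod_dvd ?expn_gt0 ?u_gt0 // expn_eq1_mod //= dvdn_pexp_mul // /vexp.
by case: ifP => _; rewrite ?andbF // andbT leq_min lt_ir andbT.
Qed.

(** If p - 1 divides j, then u^j is 1 modulo p and the valuation is that of the length, r - 1.
    Otherwise u^j - 1 is prime to p, while its product with the sum is divisible by p^r. *)
Lemma gcdn_pow_sum j : 0 < j ->
  gcdn (\sum_(l < p ^ r.-1 * p.-1) (u ^ j) ^ l) (p ^ r) = p ^ nuexp j.
Proof.
move=> j_gt0; have ndp : ~~ (p %| p.-1) by rewrite gtnNdvd //; lia.
have nu_gt0 : 0 < \sum_(l < p ^ r.-1 * p.-1) (u ^ j) ^ l.
  have : 0 < p ^ r.-1 * p.-1 by rewrite muln_gt0 expn_gt0 p_gt0; lia.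
  by case: (_ * _) => // b _; rewrite big_ord_recl expn0.
rewrite /nuexp; case: ifP => [pj|npj].
  apply: gcdn_pexp => [|i le_ir]; first exact: leq_pred.
  rewrite pfactor_dvdn // logn_sum_pow //.
  by apply/eqP; rewrite -[p in X in _ %% X]expn1 expn_eq1_mod ?mul1n ?pj.
apply: gcdn_pexp => // i le_ir; rewrite le_ir.
have : p ^ i %| p ^ r by rewrite dvdn_exp2l.
move/dvdn_trans; apply.
have cop : coprime (p ^ r) (u ^ j - 1).
  by rewrite /coprime gcdnC gcdn_pow_sub1 // /vexp npj.
rewrite -(Gauss_dvdr _ cop).
have -> : (u ^ j - 1) * \sum_(l < p ^ r.-1 * p.-1) (u ^ j) ^ l = (u ^ j) ^ (p ^ r.-1 * p.-1) - 1.
  by rewrite !subn1 [RHS]predn_exp.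
rewrite -eqn_mod_dvd ?expn_gt0; last by case: (u) u_coprime => //; rewrite /coprime gcd0n; case: (p) p_gt1 => [|[]].
by rewrite -expnM expn_eq1_mod ?r_gt0 ?leqnn // dvdn_mull.
Qed.

End PowerSums.

(** * Multiplicities *)

Lemma count_dvdn d h : 0 < d -> count (dvdn d) (iota 1 h) = h %/ d.
Proof.
move=> d_gt0; elim: h => [|h IHh]; first by rewrite div0n.
by rewrite -(addn1 h) iotaD count_cat IHh /= addn0 add1n addn1 divnS // addnC.
Qed.

Lemma count_split (T : Type) (P P1 P2 : pred T) (s : seq T) :
  (forall x, P x = P1 x + P2 x :> nat) -> count P s = count P1 s + count P2 s.
Proof. by move=> PE; elim: s => //= x s ->; rewrite PE addnACA. Qed.

Section Counting.
Variables (p r q : nat).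
Hypotheses (p_pr : prime p) (p_odd : odd p).

Let p_gt1 : 1 < p := prime_gt1 p_pr.
Let p_gt2 : 2 < p. Proof. by move: p_gt1 p_odd; case: (p) => [|[|[|]]]. Qed.
Let p1_gt0 : 0 < p.-1. Proof. by move: p_gt2; case: (p) => [|[|]]. Qed.

(* The p-part of H_q is the direct sum of the Z/p^(hexp j): the index j >= 1
   stands for the fibre degree 2j - 1, and j = 0 for the base. *)
Definition hexp j : nat :=
  if j is 0 then (if odd q then r.-1 else 0) else
  if p.-1 %| j then
    if j.*2 <= q then minn (logn p j) r.-1 else minn (logn p j).+1 r
  else 0.

(** The first summand counts the complete pairs of rows, 1 <= j <= q/2; the second is the incomplete
    pair j = (q+1)/2 on top, present for odd q; the third is j = 0. *)
Lemma hexp_count i : 0 < i <= r ->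
  count (fun j => hexp j == i) (iota 0 (uphalf q).+1) =
  (if i < r.-1 then q %/ (2 * (p - 1) * p ^ i) - q %/ (2 * (p - 1) * p ^ (i + 1))
   else if i == r.-1 then q %/ (2 * (p - 1) * p ^ i) else 0)
  + [&& odd q, p.-1 %| uphalf q & if i < r then logn p (uphalf q) == i.-1 else i.-1 <= logn p (uphalf q)]
  + (odd q && (i == r.-1)).
Proof.
case/andP=> i_gt0 le_ir.
(* The quotient counts the multiples of (p-1) p^k up to q/2; those of valuation exactly i are then a
   difference of two counts. *)
have divE k : q %/ (2 * (p - 1) * p ^ k) = count (fun j => (p.-1 %| j) && (k <= logn p j)) (iota 1 q./2).
  rewrite subn1 -mulnA divnMA divn2 -count_dvdn; last by rewrite muln_gt0 p1_gt0 expn_gt0 (ltnW p_gt1).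
  apply: eq_in_count => j; rewrite mem_iota => /andP[j_gt0 _].
  by rewrite mulnC dvdn_pexp_mul // andbC.
rewrite /= addnC; congr (_ + _); last first.
  case: (odd q) => /=; first by rewrite eq_sym.
  by case: (i) i_gt0.
have -> : count (fun j => hexp j == i) (iota 1 (uphalf q)) =
    count (fun j => hexp j == i) (iota 1 q./2) + (odd q && (hexp (uphalf q) == i)).
  rewrite uphalf_half; case: (odd q); last by rewrite addn0.
  by rewrite add1n -(addn1 q./2) iotaD count_cat /= addn0 add1n addn1.
congr (_ + _).
  rewrite !divE.
  have hE j : j \in iota 1 q./2 -> (hexp j == i) = (p.-1 %| j) && (minn (logn p j) r.-1 == i).
    rewrite mem_iota /hexp; case: j => // j ltj; have -> : j.+1.*2 <= q by move: ltj => /andP[_]; rewrite add1n ltnS geq_half_double.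
    by case: ifP => // _; case: (i) i_gt0.
  rewrite (eq_in_count hE).
  case: ltngtP => [lt_i|gt_i|i_eq].
  - rewrite (@count_split _ _ (fun j => (p.-1 %| j) && (minn (logn p j) r.-1 == i))
      (fun j => (p.-1 %| j) && (i + 1 <= logn p j))) ?addnK // => j.
    by case: (p.-1 %| j) => //=; lia.
  - by apply/eqP; rewrite -leqn0 leqNgt -has_count; apply/hasPn => j _; rewrite negb_and; lia.
  - by apply: eq_count => j; case: (p.-1 %| j) => //=; lia.
have [odd_q|] := boolP (odd q) => //=.
have /prednK <- : 0 < uphalf q by move: odd_q; case: (q).
rewrite /hexp prednK; last by move: odd_q; case: (q).
have -> : (uphalf q).*2 = q.+1 by rewrite uphalf_half odd_q doubleD -{2}[q]odd_double_half odd_q.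
rewrite ltnn; case: ifP => //= _; last by case: (i) i_gt0.
by case: ifP => ir; lia.
Qed.

(** Only k = (q+1)/2 divided by (p-1) c can satisfy the equation, and [Q] is the value of [P]
    there. *)
Lemma ex_fibre_degree c (P : nat -> bool) (Q : bool) : 0 < c ->
  (forall k, 0 < k -> P k = Q \/ uphalf q <> p.-1 * c * k) ->
  `[< exists k, [/\ 0 < k, P k & q = 2 * (p - 1) * c * k - 1] >] =
  [&& odd q, p.-1 * c %| uphalf q & Q].
Proof.
move=> c_gt0 PQ; have q1 : 0 < q \/ q = 0 by lia.
have JE k : 0 < k -> q = 2 * (p - 1) * c * k - 1 -> odd q /\ uphalf q = p.-1 * c * k.
  move=> k_gt0 qE; have e : 2 * (p - 1) * c * k = (p.-1 * c * k).*2 by rewrite subn1 -mul2n !mulnA.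
  have : 0 < p.-1 * c * k by rewrite !muln_gt0 p1_gt0 c_gt0.
  by rewrite qE e; lia.
apply/asboolP/and3P => [[k [k_gt0 Pk /(JE k k_gt0)[odd_q JE']]]|[odd_q /dvdnP[k kE] q_]].
  split=> //; first by rewrite JE' dvdn_mulr.
  by case: (PQ k k_gt0) => [<-|/(_ JE')].
have k_gt0 : 0 < k by case: k kE => //; rewrite mul0n; move: odd_q; case: (q).
exists k; split=> //; first by case: (PQ k k_gt0) => [->|] // []; rewrite kE mulnC.
have e : q.+1 = (uphalf q).*2 by rewrite uphalf_half odd_q doubleD -{1}[q]odd_double_half odd_q.
have -> : 2 * (p - 1) * c * k = q.+1 by rewrite e kE subn1 -mul2n; ring.
by rewrite subn1.
Qed.

Lemma hexp_count_mult i : 0 < r -> 0 < q -> 0 < i <= r ->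
  count (fun j => hexp j == i) (iota 0 (uphalf q).+1) = mult p r q i.
Proof.
move=> r_gt0 q_gt0 i_r; rewrite hexp_count //; case/andP: i_r => i_gt0 le_ir.
have J_gt0 : 0 < uphalf q by case: (q) q_gt0.
have top e : `[< exists k, 0 < k /\ q = 2 * (p - 1) * p ^ e * k - 1 >] =
    [&& odd q, p.-1 %| uphalf q & e <= logn p (uphalf q)].
  have -> : [&& odd q, p.-1 %| uphalf q & e <= logn p (uphalf q)] =
     [&& odd q, p.-1 * p ^ e %| uphalf q & true].
    by rewrite andbT mulnC dvdn_pexp_mul // [_ && (e <= _)]andbC.
  rewrite -(@ex_fibre_degree (p ^ e) xpredT true); last 2 first.
  - by rewrite expn_gt0 (ltnW p_gt1).
  - by left.
  by apply: asbool_equiv_eq; split=> [[k []]|[k []]]; exists k.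
have alpha e : `[< exists k, [/\ 0 < k, gcdn k p = 1 & q = 2 * (p - 1) * p ^ e * k - 1] >] =
    [&& odd q, p.-1 %| uphalf q & logn p (uphalf q) == e].
  have -> : [&& odd q, p.-1 %| uphalf q & logn p (uphalf q) == e] =
     [&& odd q, p.-1 * p ^ e %| uphalf q & logn p (uphalf q) == e].
    by rewrite mulnC dvdn_pexp_mul //; case: odd => //=; lia.
  rewrite -(@ex_fibre_degree (p ^ e) (fun k => gcdn k p == 1)); last 2 first.
  - by rewrite expn_gt0 (ltnW p_gt1).
  - move=> k k_gt0; case: (eqVneq (uphalf q) (p.-1 * p ^ e * k)) => [JE|/eqP]; last by right.
    left; rewrite JE -mulnA lognM ?muln_gt0 ?expn_gt0 ?(ltnW p_gt1) ?k_gt0 ?p1_gt0 //.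
    rewrite lognM ?expn_gt0 ?(ltnW p_gt1) // pfactorK //.
    (* As p does not divide p - 1, any valuation beyond e comes from k. *)
    have -> : logn p p.-1 = 0.
      apply/eqP; rewrite -leqn0 leqNgt logn_gt0 mem_primes p_pr p1_gt0 /= gtnNdvd //; lia.
    rewrite add0n -[X in _ = (_ == X)]addn0 eqn_add2l -leqn0 leqNgt logn_gt0 mem_primes p_pr k_gt0 /=.
    by rewrite -prime_coprime // coprime_sym.
  by apply: asbool_equiv_eq; split=> [[k [k0 /eqP]]|[k [k0 /eqP]]]; exists k.
rewrite /mult; case: (eqVneq r 1) => [r1|nr1].
  have i1 : i = 1 by lia.
  have := top 0; rewrite leq0n => top0; rewrite r1 i1 /= andbF addn0 add0n /mult1 -top0.
  by congr nat_of_bool; apply: asbool_equiv_eq; rewrite expn0 muln1.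
case: (eqVneq r 2) => [r2|nr2].
  rewrite r2 /mult2; case: (eqVneq i 1) => [->|ni1] /=.
    rewrite andbT expn1; congr (_ + _ + _).
    rewrite -(alpha 0); congr nat_of_bool; apply: asbool_equiv_eq; rewrite expn0 muln1 //.
  have -> : i = 2 by lia.
  rewrite /= andbF addn0 add0n -(top 1); congr nat_of_bool; apply: asbool_equiv_eq; rewrite expn1 //.
rewrite /mult3 /mult3_alpha !alpha top.
case: (leqP i (r - 2)) => le_i2.
  have -> : i < r.-1 by lia.
  have -> : i < r by lia.
  have -> : (i == r.-1) = false by lia.
  by rewrite andbF addn0 !subn1.
have -> : (i < r.-1) = false by lia.
rewrite !subn1; case: (eqVneq i r.-1) => [->|ni].
  have -> : (r.-1 < r) = true by lia.
  by rewrite andbT.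
have -> : i = r by lia.
by rewrite ltnn andbF addn0.
Qed.

End Counting.

(** * The holomorph of a cyclic group *)

Lemma aut_app_id (L : finGroupType) (h : aut_of L) : aut_app h 1%g = 1%g.
Proof. by apply: (@mulgI _ (aut_app h 1%g)); rewrite -aut_appM !mulg1. Qed.

Section HolZ.
Variables (p r : nat).
Hypotheses (p_pr : prime p) (p_odd : odd p) (r_gt0 : 0 < r).
Local Notation K := 'Z_(p ^ r).

Let m_gt1 : 1 < p ^ r.
Proof. by rewrite -(exp1n r) ltn_exp2r // prime_gt1. Qed.

Lemma Zp_expgE (k : nat) : ((1%R : K) ^+ k)%g = (k%:R)%R.
Proof. by rewrite FinRing.zmodXgE. Qed.

Lemma cyclic_ZpT : cyclic [set: K].
Proof.
apply/cyclicP; exists 1%R; apply/setP=> a; rewrite inE; apply/esym/cycleP.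
by exists a; rewrite Zp_expgE natr_Zp.
Qed.

Lemma aut_ZpE (f : {perm K}) (a : K) : f \in Aut [set: K] -> f a = (f 1 * a)%R.
Proof.
move=> /setIdP[_ /morphicP fM].
have fX k : f ((1%R : K) ^+ k)%g = (f 1%R ^+ k)%g.
  elim: k => [|k IHk].
    by apply: (@mulgI _ (f 1%g)); rewrite -fM ?inE // !mulg1.
  by rewrite !expgS fM ?inE // IHk.
by rewrite -[a in LHS]natr_Zp -Zp_expgE fX FinRing.zmodXgE -mulr_natr natr_Zp.
Qed.

Lemma aut_Zp_generator : exists2 f : {perm K}, Aut [set: K] = <[f]>%g &
  forall y, coprime y p -> exists2 h, h \in Aut [set: K] & h 1%R = (y%:R)%R.
Proof.
have oK : #|[set: K]| = p ^ r by rewrite cardsT card_ord Zp_cast.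
have pK : (p.-group [set: K])%g by rewrite /pgroup oK pnatX pnat_id.
have nK : [set: K]%G :!=: 1%g by rewrite -cardG_gt1 oK.
have [mu [[muE _ [_ mu_im] _ _] [_ cF _ _] muA]] := cyclic_pgroup_Aut_structure pK cyclic_ZpT nK.
have cA : cyclic (Aut [set: K]).
  (* For r = 1 the automorphism group reduces to its part of order prime to p. *)
  have [n0|/negPf n0] := boolP ((logn p #|[set: K]|).-1 == 0).
    by move: muA; rewrite /= n0 => ->.
  by move: muA; rewrite /= n0 p_odd => -[t [_ _ _ [[]]]].
have [f fE] := cyclicP cA; exists f => // y y_p.
have : (y%:R : 'Z_#|[set: K]|)%R \is a GRing.unit.
  by rewrite unitZpE oK // coprime_pexpl // coprime_sym.
rewrite -[_ \is a _]/(_ \in GRing.unit) -mu_im => /imageP[h hA yE].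
exists h => //; have := muE h 1%R hA (in_setT _); rewrite FinRing.zmodXgE => <-; rewrite -yE.
by apply: val_inj; rewrite /= !val_Zp_nat ?oK // modn_mod.
Qed.

Lemma card_Aut_Zp : #|Aut [set: K]| = p ^ r.-1 * p.-1.
Proof.
by rewrite (card_Aut_cyclic cyclic_ZpT) cardsT card_ord Zp_cast // totient_pfactor // mulnC.
Qed.

(* [s] is the inverse of the automorphism [a |-> u * a]. *)
Lemma hol_Zp_normal_form : exists (x s : hol K) (u c : nat) (iS kX : hol K -> nat),
  [/\ [/\ coprime u p, forall y, coprime y p -> exists k, u ^ k = y %[mod p ^ r]
        & u ^ (p ^ r.-1 * p.-1) = 1 + c * p ^ r],
      [/\ (x ^+ (p ^ r) = 1)%g, (s ^+ (p ^ r.-1 * p.-1) = 1)%g & (x * s = s * x ^+ u)%g],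
      forall i k, iS (s ^+ i * x ^+ k)%g = i %% (p ^ r.-1 * p.-1),
      forall i k, kX (s ^+ i * x ^+ k)%g = k %% p ^ r
    & forall g, (g = s ^+ iS g * x ^+ kX g)%g].
Proof.
have [f fE f_unit] := aut_Zp_generator; set n := p ^ r.-1 * p.-1.
have fA : f \in Aut [set: K] by rewrite fE cycle_id.
have of_ : #[f]%g = n by rewrite orderE -fE card_Aut_Zp.
pose sf : aut_of K := subg _ f.
have sfE : sgval sf = f by exact: subgK.
have sfX k : sgval (sf ^+ k)%g = (f ^+ k)%g.
  by rewrite morphX ?inE //=; congr (_ ^+ _)%g; exact: subgK.
pose sg : aut_of K := (sf^-1)%g.
have osg : #[sg]%g = n.
  by rewrite orderV -of_ -(order_injm (injm_sgval _)) ?inE //= subgK.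
pose u := nat_of_ord (f 1%R : K).
have fu a : f a = (u%:R * a)%R by rewrite aut_ZpE // natr_Zp.
have fX1 k : (f ^+ k)%g 1%R = ((u ^ k)%:R)%R.
  elim: k => [|k IHk]; first by rewrite perm1.
  by rewrite expgSr permM IHk fu -natrM expnS.
have natK a b : ((a%:R : K) == b%:R)%R = (a == b %[mod p ^ r]).
  by rewrite -val_eqE /= !val_Zp_nat.
have un : u ^ n = 1 %[mod p ^ r].
  by apply/eqP; rewrite -natK -fX1 -of_ expg_order perm1.
have n_gt0 : 0 < n by rewrite -of_ order_gt0.
have u_cop : coprime u p.
  have : coprime (u ^ n) (p ^ r) by rewrite /coprime -gcdn_modl un gcdn_modl gcd1n.
  by rewrite coprime_pexpl // coprime_pexpr.
have u_gt0 : 0 < u.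
  by rewrite lt0n; apply: contraTneq u_cop => ->; rewrite /coprime gcd0n; case: (p) p_pr => [|[]].
pose x : hol K := Hol (1%g : aut_of K) (1%R : K); pose s : hol K := Hol sg (1%g : K).
have xX k : (x ^+ k)%g = Hol (1%g : aut_of K) (k%:R%R : K).
  elim: k => [|k IHk] //; rewrite expgS IHk -[LHS]/(hol_mul x (Hol 1%g _)) /=.
  by rewrite /aut_comp mulg1 invg1 aut_app1 FinRing.zmodMgE -natr1 addrC.
have sX k : (s ^+ k)%g = Hol (sg ^+ k)%g (1%g : K).
  elim: k => [|k IHk] //; rewrite expgS IHk -[LHS]/(hol_mul s (Hol _ _)) /=.
  by rewrite /aut_comp -expgSr mulg1 aut_app_id.
have sxE i k : (s ^+ i * x ^+ k)%g = Hol (sg ^+ i)%g (k%:R%R : K).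
  rewrite sX xX -[LHS]/(hol_mul (Hol _ _) (Hol _ _)) /= /aut_comp mul1g.
  by rewrite invg1 aut_app1 mul1g.
have /choice[iS iSE] (h : aut_of K) : exists i, i < n /\ h = (sg ^+ i)%g.
  have /cyclePmin[i lti hE] : (sgval h)^-1%g \in <[f]>%g by rewrite -fE groupV subgP.
  exists i; split; first by rewrite -of_.
  by apply: (can_inj (@sgvalK _ _)); rewrite expgVn morphV ?inE //= sfX -hE invgK.
exists x, s, u, (u ^ n %/ p ^ r), (fun g => iS (hol_aut g)), (fun g => nat_of_ord (hol_elt g : K)).
split.
- split=> // [y /f_unit[h]|]; last first.
    by rewrite [LHS](divn_eq _ (p ^ r)) un modn_small // addnC.
  rewrite fE => /cycleP[k ->] /eqP; rewrite fX1 natK => /eqP uE.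
  by exists k.
- split; first by rewrite xX; congr Hol; apply/eqP; rewrite (natK _ 0) modnn mod0n.
    by rewrite sX -osg expg_order.
  (* The product rule applies the inverse of [sg], which is [f], to the element 1 of x and so yields
     u. *)
  have := sxE 1 u; rewrite !expg1 => ->; rewrite -[LHS]/(hol_mul x s) /= /aut_comp mulg1.
  rewrite mulg1 /aut_app invgK; congr Hol.
  by rewrite sfE fu mulr1.
- move=> i k; rewrite sxE /=; have [lti /eqP] := iSE (sg ^+ i)%g.
  by rewrite eq_expg_mod_order osg [iS _ %% _]modn_small // => /eqP.
- by move=> i k; rewrite sxE /= val_Zp_nat.
- by case=> h a; rewrite sxE /= natr_Zp -(iSE h).2.
Qed.

End HolZ.

Lemma Zp_intr_eq0 k (z : int) : 1 < k -> (z%:~R == 0 :> 'Z_k)%R = (k%:Z %| z)%Z.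
Proof.
move=> k_gt1; have natE a : ((a%:R : 'Z_k) == 0)%R = (k %| a).
  by rewrite -val_eqE /= val_Zp_nat.
case: z => a; first by rewrite -pmulrn natE.
by rewrite NegzE mulrNz oppr_eq0 -pmulrn natE.
Qed.

Lemma dvdn_pexp_mulr p r A a b : A <= r -> 0 < p -> gcdn b (p ^ r) = p ^ A ->
  (p ^ r %| a * b) = (p ^ (r - A) %| a).
Proof.
move=> le_Ar p_gt0 gE; have pA_gt0 : 0 < p ^ A by rewrite expn_gt0 p_gt0.
have /dvdnP[b' bE] : p ^ A %| b by rewrite -gE dvdn_gcdl.
have rE : p ^ r = p ^ A * p ^ (r - A) by rewrite -expnD subnKC.
have cop : coprime (p ^ (r - A)) b'.
  rewrite coprime_sym /coprime -(eqn_pmul2l pA_gt0) muln_gcdr -rE [p ^ A * b']mulnC -bE gE.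
  by rewrite muln1.
by rewrite bE mulnA mulnC rE dvdn_pmul2l // Gauss_dvdl.
Qed.

Lemma dvdz_gcdnP (d m : nat) z : ((gcdn d m)%:Z %| z)%Z <->
  exists x y, (z = x * d%:Z + y * m%:Z)%R.
Proof.
split=> [/dvdzP[k ->]|[x [y ->]]].
  have [x [y xyE]] := Bezoutz d m.
  by exists (k * x)%R, (k * y)%R; rewrite -!mulrA -mulrDr xyE.
by rewrite rpredD // dvdz_mull // dvdzE /= ?dvdn_gcdl ?dvdn_gcdr.
Qed.

(** * Coordinates on the direct sum of cyclic groups *)

Section Target.
Variables (p r q : nat).
Hypotheses (p_pr : prime p) (p_odd : odd p) (r_gt0 : 0 < r).

Definition hol_target : zmodType :=
  (dsum (fun i : 'I_r => dcopies (mult p r q i.+1) 'Z_(p ^ i.+1))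
   * dcopies (odd q) 'Z_(p - 1))%type.

(** The position of a coordinate in this list is the copy of Z/p^i that receives it. *)
Definition hexp_idx i : seq nat := [seq j <- iota 0 (uphalf q).+1 | hexp p r q j == i].

(** For odd q, coordinate 0 is used twice: its class modulo p^(r-1) (p-1) splits into a p-part,
    trivial when r = 1, and a class modulo p - 1. *)
Definition hol_coords (C : nat -> int) : hol_target :=
  (([ffun i : 'I_r => [ffun l : 'I_(mult p r q i.+1) =>
      (C (nth 0 (hexp_idx i.+1) l))%:~R : 'Z_(p ^ i.+1)]]
      : dsum (fun i : 'I_r => dcopies (mult p r q i.+1) 'Z_(p ^ i.+1))),
   [ffun l : 'I_(odd q) => (C 0)%:~R : 'Z_(p - 1)])%R.

Let p_gt2 : 2 < p.
Proof. by move: (prime_gt1 p_pr) p_odd; case: (p) => [|[|[|]]]. Qed.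

Hypothesis q_gt0 : 0 < q.

Let size_idx (i : 'I_r) : size (hexp_idx i.+1) = mult p r q i.+1.
Proof. by rewrite size_filter hexp_count_mult // ltn_ord. Qed.

Let nth_idx (i : 'I_r) (l : 'I_(mult p r q i.+1)) (j := nth 0 (hexp_idx i.+1) l) :
  hexp p r q j = i.+1 /\ j <= uphalf q.
Proof.
have : j \in hexp_idx i.+1 by rewrite mem_nth // size_idx.
by rewrite mem_filter mem_iota => /andP[/eqP].
Qed.

Let pX_gt1 i : 1 < p ^ i.+1.
Proof. by rewrite -(exp1n i.+1) ltn_exp2r // prime_gt1. Qed.

Lemma hol_coordsB C C' : hol_coords (fun j => C j - C' j)%R = (hol_coords C - hol_coords C')%R.
Proof.
congr (_, _).
  by apply/ffunP=> i; rewrite !ffunE; apply/ffunP=> l; rewrite !ffunE mulrzBr.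
by apply/ffunP=> l; rewrite !ffunE mulrzBr.
Qed.

Lemma hol_coords_ext C C' :
  (forall j, j <= uphalf q -> (j == 0) ==> odd q -> C j = C' j) ->
  hol_coords C = hol_coords C'.
Proof.
move=> CC'; congr (_, _).
  apply/ffunP=> i; rewrite !ffunE; apply/ffunP=> l; rewrite !ffunE CC' //.
    by case: (nth_idx l).
  case: (nth_idx l); case: (nth _ _ _) => //=.
  by case: (odd q).
apply/ffunP=> l; rewrite !ffunE CC' //.
by case: (odd q) l => // -[].
Qed.

Lemma hol_coords_surj (X : hol_target) : exists C, hol_coords C = X.
Proof.
case: X => X1 X2.
have /choice[C CE] j : exists z : int,
    (forall (i : 'I_r) (l : 'I_(mult p r q i.+1)), nth 0 (hexp_idx i.+1) l = j ->
      z%:~R%R = X1 i l :> 'Z_(p ^ i.+1)) /\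
    (j = 0 -> forall l : 'I_(odd q), z%:~R%R = X2 l :> 'Z_(p - 1)).
  (* [hexp] determines the summand of coordinate j, and its place is unique because the list has no
     repetition; so at most one condition is imposed. *)
  have [a aE] : exists a : nat, forall (i : 'I_r) (l : 'I_(mult p r q i.+1)),
      nth 0 (hexp_idx i.+1) l = j -> a%:R%R = X1 i l :> 'Z_(p ^ i.+1).
    have [[i [l lE]]|nil] := pselect (exists (i : 'I_r) (l : 'I_(mult p r q i.+1)),
        nth 0 (hexp_idx i.+1) l = j); last first.
      by exists 0 => i l lE; case: nil; exists i, l.
    exists (X1 i l : nat) => i' l' lE'.
    have ii' : i' = i.
      apply/val_inj/succn_inj; rewrite -(nth_idx l).1 -(nth_idx l').1.
      by rewrite lE lE'.
    rewrite {}ii' in l' lE' *.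
    have -> : l' = l.
      apply/val_inj/eqP; rewrite /= -(nth_uniq 0 (s := hexp_idx i.+1)) ?size_idx //.
        by rewrite lE lE'.
      by rewrite filter_uniq // iota_uniq.
    by rewrite natr_Zp.
  have [/negPf even_q|odd_q] : {~~ odd q} + {odd q} by case: odd; [right|left].
    exists (Posz a); split=> [i l /aE <-|_ l]; first by rewrite -pmulrn.
    by have := leq_trans (ltn_ord l) (eq_leq (congr1 nat_of_bool even_q)).
  have [b bE] : exists b : nat, forall l : 'I_(odd q), b%:R%R = X2 l :> 'Z_(p - 1).
    have lt0 : 0 < odd q by rewrite odd_q.
    exists (X2 (Ordinal lt0) : nat) => l; rewrite natr_Zp; congr (X2 _).
    apply/val_inj/eqP; rewrite eq_sym -leqn0 -ltnS.
    exact: leq_trans (ltn_ord l) (leq_b1 _).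
  have cop : coprime (p ^ r) (p - 1).
    by rewrite subn1 coprimeXl // -{1}(prednK (prime_gt0 p_pr)) coprimeSn.
  (* The p-part and the class modulo p - 1 are prescribed together by the Chinese remainder
     theorem. *)
  exists (Posz (chinese (p ^ r) (p - 1) a b)); split=> [i l lE|_ l]; rewrite -pmulrn.
    rewrite -(aE i l lE); apply: val_inj; rewrite /= !val_Zp_nat //.
    have dvdi : p ^ i.+1 %| p ^ r by rewrite dvdn_exp2l.
    by rewrite -(modn_dvdm _ dvdi) chinese_modl // modn_dvdm.
  rewrite -bE; apply: val_inj; rewrite /= !val_Zp_nat ?chinese_modr //; lia.
exists C; congr (_, _).
  by apply/ffunP=> i; rewrite !ffunE; apply/ffunP=> l; rewrite !ffunE; apply: (CE _).1.
by apply/ffunP=> l; rewrite !ffunE; apply: (CE 0).2.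
Qed.

Lemma hol_coords_eq0 C : hol_coords C = 0%R <->
  (forall j, 0 < j <= uphalf q -> ((p ^ hexp p r q j)%N%:Z %| C j)%Z) /\
  (odd q -> ((p ^ r.-1 * p.-1)%N%:Z %| C 0%N)%Z).
Proof.
have fibre : hol_coords C = 0%R <->
    (forall j, j <= uphalf q -> ((p ^ hexp p r q j)%N%:Z %| C j)%Z) /\
    (odd q -> ((p - 1)%N%:Z %| C 0%N)%Z).
  split=> [[C1 C2]|[C1 C2]].
    split=> [j le_j|odd_q]; last first.
      have lt0 : 0 < odd q by rewrite odd_q.
      have /ffunP/(_ (Ordinal lt0)) := C2; rewrite !ffunE => /eqP.
      by rewrite Zp_intr_eq0 //; lia.
    case hE : (hexp p r q j) => [|i]; first by rewrite expn0 dvd1z.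
    have lt_ir : i < r.
      rewrite -hE; case: j {le_j hE} => [|j] /=; first by case: odd; lia.
      by case: ifP => // _; case: ifP => _; rewrite geq_min ?leqnn ?orbT //; lia.
    have jI : j \in hexp_idx i.+1 by rewrite mem_filter hE eqxx mem_iota.
    have ltl : index j (hexp_idx i.+1) < mult p r q i.+1.
      by rewrite -(size_idx (Ordinal lt_ir)) index_mem.
    have /ffunP/(_ (Ordinal lt_ir)) := C1; rewrite !ffunE => /ffunP/(_ (Ordinal ltl)).
    by rewrite !ffunE /= nth_index // => /eqP; rewrite Zp_intr_eq0.
  congr (_, _); apply/ffunP.
    move=> i; rewrite !ffunE; apply/ffunP=> l; rewrite !ffunE.
    apply/eqP; rewrite Zp_intr_eq0 //; have [hE le_j] := nth_idx l.
    by move: (C1 _ le_j); rewrite hE.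
  move=> l; rewrite !ffunE; apply/eqP; rewrite Zp_intr_eq0; last by lia.
  by apply: C2; case: (odd q) l => // -[].
have zeroE : (odd q -> ((p ^ r.-1 * p.-1)%N%:Z %| C 0%N)%Z) <->
    ((p ^ hexp p r q 0)%N%:Z %| C 0%N)%Z /\ (odd q -> ((p - 1)%N%:Z %| C 0%N)%Z).
  rewrite /=; case: (odd q) => /=; last by rewrite dvd1z; split.
  have cop : coprimez (Posz (p ^ r.-1)) (Posz p.-1).
    by rewrite coprimezE /= coprimeXl // -{1}(prednK (prime_gt0 p_pr)) coprimeSn.
  rewrite PoszM (Gauss_dvdz _ cop) subn1.
  by split=> [/(_ isT)/andP[-> ->]|[-> /(_ isT) ->]].
rewrite fibre zeroE; split=> [[C1 C2]|[C1 [C0 C2]]]; split=> //.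
- by move=> j /andP[_ /C1].
- by split=> //; apply: C1.
- by case=> // j /= ltj; apply: C1.
Qed.

End Target.

(** * Orders of the summands for a primitive root *)

Section SplitHomology.
Variables (p r q u c : nat).
Hypotheses (p_pr : prime p) (p_odd : odd p) (r_gt0 : 0 < r).
Hypothesis u_gen : forall y, coprime y p -> exists k, u ^ k = y %[mod p ^ r].
Hypothesis u_coprime : coprime u p.

Local Notation m := (p ^ r).
Local Notation n := (p ^ r.-1 * p.-1).
Hypothesis uE : u ^ n = 1 + c * m.

Definition hol_delta (b : bool) j : int :=
  (if b then u%:R ^+ j - 1 else \sum_(l < n) (u%:R ^+ j) ^+ l)%R.

Let p_gt0 : 0 < p := prime_gt0 p_pr.
Let m_gt0 : 0 < m. Proof. by rewrite expn_gt0 p_gt0. Qed.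
Let p1_gt0 : 0 < p.-1. Proof. by have := prime_gt1 p_pr; lia. Qed.
Let n_gt0 : 0 < n. Proof. by rewrite muln_gt0 expn_gt0 p_gt0 p1_gt0. Qed.
Let u_gt0 : 0 < u.
Proof. by rewrite lt0n; apply: contraTneq u_coprime => ->; rewrite /coprime gcd0n; case: (p) p_pr => [|[]]. Qed.

Let dexp (b : bool) j := if b then vexp p r j else nuexp p r j.
Let dnat (b : bool) j := if b then u ^ j - 1 else \sum_(l < n) (u ^ j) ^ l.

Let deltaE b j : hol_delta b j = Posz (dnat b j).
Proof.
rewrite /hol_delta /dnat; case: b; rewrite -natz.
  by rewrite natrB ?natrX // expn_gt0 u_gt0.
by rewrite natr_sum; apply: eq_bigr => l _; rewrite -!natrX.
Qed.

Let dexp_le b j : dexp b j <= r.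
Proof.
case: b => /=; first by rewrite /vexp; case: ifP => // _; exact: geq_minr.
by rewrite /nuexp; case: ifP => // _; exact: leq_pred.
Qed.

Let gcd_dnat b j : 0 < j -> gcdn (dnat b j) m = p ^ dexp b j.
Proof. by case: b => j_gt0; [exact: gcdn_pow_sub1 | exact: gcdn_pow_sum]. Qed.

Let dexp_add b j : dexp b j + dexp (~~ b) j = vexp p r j + nuexp p r j.
Proof. by case: b; rewrite //= addnC. Qed.

(** [A] and [B] are the p-exponents of the base differentials leaving and entering the pair j.
    Cycles give the ideal of p^(r - A), boundaries that of p^B, hence the order p^(A + B - r); A = r
    encodes the absence of a condition. *)
Let A j := if j.*2 <= q.+1 then dexp (odd q) j else r.
Let B j := dexp (~~ odd q) j.
Let b j := p ^ (r - A j).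
Let o j := p ^ (A j + B j - r).

Let A_le j : A j <= r.
Proof. by rewrite /A; case: ifP. Qed.

Let AB_ge j : r <= A j + B j.
Proof.
rewrite /A; case: ifP => _; last exact: leq_addr.
by rewrite dexp_add /vexp /nuexp; case: ifP => _; lia.
Qed.

Let b_gt0 j : 0 < b j. Proof. by rewrite expn_gt0 p_gt0. Qed.

Let bP j (z : int) : 0 < j ->
  (Posz (b j) %| z)%Z <-> (j.*2 <= q.+1 -> (Posz m %| (z * hol_delta (odd q) j)%R)%Z).
Proof.
move=> j_gt0; rewrite deltaE !dvdzE abszM /= /b /A; case: ifP => _; last first.
  by rewrite subnn dvd1n.
by rewrite (dvdn_pexp_mulr _ (dexp_le _ _) p_gt0 (gcd_dnat _ j_gt0)); split=> // /(_ isT).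
Qed.

Let boP j (z : int) : 0 < j -> (Posz (b j * o j) %| z)%Z <->
  exists x y, (z = x * hol_delta (~~ odd q) j + y * m%:R)%R.
Proof.
move=> j_gt0; have -> : b j * o j = gcdn (dnat (~~ odd q) j) m.
  by rewrite gcd_dnat // -expnD; congr (p ^ _); have := A_le j; have := AB_ge j; rewrite /B; lia.
by rewrite dvdz_gcdnP deltaE natz.
Qed.

(** A complete pair has exponent [vexp + nuexp - r] for either parity of q. An incomplete one occurs
    only for even q, and its exponent is [vexp] because A = r. *)
Let oE j : 0 < j <= uphalf q.+1 -> o j = p ^ hexp p r q.+1 j.
Proof.
case: j => // j /= ltj; congr (p ^ _); rewrite /A /B /hexp.
case: ifP => le_j.
  by rewrite dexp_add /vexp /nuexp; case: ifP => _; lia.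
have -> : ~~ odd q by lia.
by rewrite /= addKn /vexp.
Qed.

Let delta_mul e j : (hol_delta e j * hol_delta (~~ e) j = m%:R * (wall_a n u c j)%:R)%R.
Proof.
have E : ((u%:R ^+ j - 1) * (\sum_(l < n) (u%:R ^+ j) ^+ l) = m%:R * (wall_a n u c j)%:R :> int)%R.
  rewrite -subrX1 -exprM mulnC exprM -!natrX (wall_a_eq m_gt0 n_gt0 uE) natrD natrM.
  by rewrite addrAC subrr add0r mulrC.
by rewrite /hol_delta; case: e => //=; rewrite mulrC.
Qed.

Let delta_t0 : hol_delta true 0 = 0%R. Proof. by rewrite /hol_delta subrr. Qed.
Let delta_f0 : hol_delta false 0 = (n%:R)%R.
Proof.
rewrite /hol_delta; under eq_bigr => l _ do rewrite expr0 expr1n.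
by rewrite sumr_const card_ord.
Qed.

Local Notation M := (split_mx m (wall_a n u c) hol_delta).
Hypothesis M_mul : forall k, (M k.+1 *m M k = 0)%R.

Lemma hol_split_homology : exists f : 'rV[int]_(q.+2) -> hol_target p r q.+1,
  computes_homology (M q) (M q.+1) f.
Proof.
exists (fun v => hol_coords p r q.+1 (fun j => split_coord b j v)); split.
- move=> v w v0 w0; rewrite -hol_coordsB.
  apply: (hol_coords_ext p_pr p_odd r_gt0) => // j _ _.
  exact: (split_coordB m_gt0 delta_mul b_gt0 bP).
- move=> X; have [C <-] := hol_coords_surj p_pr p_odd r_gt0 (ltn0Sn q) X.
  have [v v0 vE] := split_coord_surj m_gt0 n_gt0 delta_t0 delta_f0 delta_mul b_gt0 bP C.
  by exists v => //; apply: (hol_coords_ext p_pr p_odd r_gt0) => // j; exact: vE.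
move=> v v0; rewrite (split_boundaryP m_gt0 n_gt0 delta_t0 delta_f0 delta_mul M_mul b_gt0 bP boP v0).
rewrite (hol_coords_eq0 p_pr p_odd r_gt0 (ltn0Sn q)).
by split=> -[C1 C2]; split=> // j jP; have := C1 j jP; rewrite oE.
Qed.

End SplitHomology.

Theorem mainTheorem14 (p r q : nat) :
  prime p -> odd p -> (1 <= r)%N -> (1 <= q)%N ->
  zmod_isomorphic
    (homology (hol 'Z_(p ^ r)) q)
    (dsum (fun i : 'I_r => dcopies (mult p r q i.+1) 'Z_(p ^ i.+1))
     * dcopies (odd q) 'Z_(p - 1))%type.
Proof.
move=> p_pr p_odd r_gt0; case: q => // q _.
have [x [s [u [c [iS [kX [[u_cop u_gen uE] [xm sn xs] iSE kXE nfE]]]]]]] :=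
  hol_Zp_normal_form p_pr p_odd r_gt0.
have p_gt1 := prime_gt1 p_pr.
have m_gt0 : 0 < p ^ r by rewrite expn_gt0 ltnW.
have n_gt0 : 0 < p ^ r.-1 * p.-1 by rewrite muln_gt0 expn_gt0; lia.
pose W := wall_resolution m_gt0 n_gt0 uE xm sn xs iSE kXE nfE.
have WE k : coinv_dif W k =
    split_mx (p ^ r) (wall_a (p ^ r.-1 * p.-1) u c) (hol_delta p r u) k.
  exact: wall_coinv_dif.
have M_mul k : (split_mx (p ^ r) (wall_a (p ^ r.-1 * p.-1) u c) (hol_delta p r u) k.+1 *m
    split_mx (p ^ r) (wall_a (p ^ r.-1 * p.-1) u c) (hol_delta p r u) k = 0)%R.
  by have E := coinv_dif_dif W k; rewrite !WE in E; exact: E.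
have [f fH] := hol_split_homology q p_pr p_odd r_gt0 u_gen u_cop uE M_mul.
have fW : computes_homology (coinv_dif W q) (coinv_dif W q.+1) f by rewrite !WE.
have [g gH] := comparison_homology (bar_resolution _) fW.
exact: homology_isomorphic gH.
Qed.
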